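(* Let $k$ be an algebraically closed field of characteristic $0$ and let $d>1$ be an integer. Then the Picard group $\mathrm{Pic}(\mathcal{M}_d)$ is trivial.
   Context: $\mathrm{Rat}_d\subset\mathbb{P}^{2d+1}$ is the open subvariety of pairs $[F:G]$ of binary forms of degree $d$ over $k$ with nonvanishing resultant; its points are the rational maps $\phi:\mathbb{P}^1\to\mathbb{P}^1$ of degree $d$. $\mathrm{SL}_2$ acts on it by conjugation $\phi^f=f^{-1}\circ\phi\circ f$, and $\mathcal{M}_d=\mathrm{Rat}_d/\mathrm{SL}_2$ is the geometric quotient variety. *)

(* Defs.v *)
From HB Require Import structures.
From mathcomp Require Import all_boot all_order all_algebra.
From mathcomp Require Import generic_quotient.
From mathcomp Require Import mathcomp_extra boolp classical_sets functions.
From mathcomp Require Import topology_structure quotient_topology subtype_topology.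
From mathcomp Require Import mpoly ring.

Set Implicit Arguments.
Unset Strict Implicit.
Unset Printing Implicit Defensive.

Import GRing.Theory.
Local Open Scope classical_set_scope.
Local Open Scope ring_scope.
Local Open Scope quotient_scope.

(** * Varieties over an algebraically closed field, as spaces with functions

    Over an algebraically closed field a variety is determined by its set of
    closed points, its Zariski topology and its sheaf of k-valued regular
    functions; this is the language used throughout. *)

Record opens (X : topologicalType) := Opens {
  opens_set :> set X;
  opens_open : open opens_set
}.

Definition submap (X Y : Type) (g : Y -> X) (V : set Y) (U : set X)
    (h : V `<=` g @^-1` U) (y : V) : U :=
  exist _ (g (val y)) (mem_set (h _ (set_valP y))).

Definition incl (X : Type) (V U : set X) (h : V `<=` U) : V -> U :=
  @submap X X id V U h.

Record fspace (k : fieldType) := FSpace {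
  fspace_top :> topologicalType;
  regular_on : forall U : opens fspace_top, set (U -> k);
  regular_cst : forall U (c : k), regular_on (fun _ : opens_set U => c);
  regularB : forall U (f g : opens_set U -> k),
    regular_on f -> regular_on g -> regular_on (f - g);
  regularM : forall U (f g : opens_set U -> k),
    regular_on f -> regular_on g -> regular_on (f * g);
  regular_restr : forall (U V : opens fspace_top) (h : V `<=` U) (f : U -> k),
    regular_on f -> regular_on (f \o incl h);
  regular_local : forall (U : opens fspace_top) (f : U -> k),
    (forall x, opens_set U x -> exists (V : opens fspace_top) (h : V `<=` U),
      opens_set V x /\ regular_on (f \o incl h)) ->
    regular_on f
}.

Section RegularFunctions.
Variables (k : fieldType) (X : fspace k).

Definition regularp (U : opens X) : {pred (U -> k)} :=
  fun f => `[< regular_on f >].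

Lemma regularpP (U : opens X) (f : U -> k) :
  reflect (regular_on f) (f \in @regularp U).
Proof. exact: asboolP. Qed.

Lemma regularp_subring (U : opens X) : subring_closed (@regularp U).
Proof.
split.
- exact/regularpP/regular_cst.
- by move=> f g /regularpP hf /regularpP hg; apply/regularpP/regularB.
- by move=> f g /regularpP hf /regularpP hg; apply/regularpP/regularM.
Qed.

(* The zero ring when U is empty. *)
Record regfun (U : opens X) := RegFun {
  regfun_val :> U -> k;
  _ : regfun_val \in @regularp U
}.

HB.instance Definition _ U := [isSub for @regfun_val U].
HB.instance Definition _ U := [Choice of regfun U by <:].
HB.instance Definition _ U := 
  GRing.SubChoice_isSubComPzRing.Build _ _ (regfun U) (@regularp_subring U).

Lemma regfunP (U : opens X) (f : regfun U) : regular_on f.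
Proof. by case: f => f /= /regularpP. Qed.

Definition regfun_res (U V : opens X) (h : V `<=` U) (f : regfun U) : regfun V :=
  RegFun (introT (regularpP _) (regular_restr h (regfunP f))).

End RegularFunctions.

(** * Sheaves of modules, invertible sheaves, the Picard group *)

Record omodule (k : fieldType) (X : fspace k) := OModule {
  sections :> forall U : opens X, lmodType (regfun U);
  res : forall U V : opens X, V `<=` U -> sections U -> sections V;
  resD : forall U V (h : opens_set V `<=` opens_set U) (s t : sections U),
    res h (s + t) = res h s + res h t;
  resZ : forall U V (h : opens_set V `<=` opens_set U)
      (a : regfun U) (s : sections U),
    res h (a *: s) = regfun_res h a *: res h s;
  res_id : forall U (h : opens_set U `<=` opens_set U) (s : sections U),
    res h s = s;
  res_comp : forall U V W (h : opens_set V `<=` opens_set U)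
      (h' : opens_set W `<=` opens_set V) (h'' : opens_set W `<=` opens_set U)
      (s : sections U),
    res h' (res h s) = res h'' s;
  res_glue : forall (U : opens X) (I : Type) (V : I -> opens X)
      (h : forall i, V i `<=` U) (s : forall i, sections (V i)),
    U `<=` \bigcup_i V i ->
    (forall i j (W : opens X) (hi : W `<=` V i) (hj : W `<=` V j),
      res hi (s i) = res hj (s j)) ->
    exists! t : sections U, forall i, res (h i) t = s i
}.

Section Picard.
Variables (k : fieldType) (X : fspace k).
Implicit Types (U V W : opens X) (L M N : omodule X).

(* An isomorphism of the restrictions of L and M to the open subspace W. *)
Definition omodule_iso_over W L M : Prop :=
  exists phi : forall V, V `<=` W -> {linear L V -> M V},
    (forall V (h : V `<=` W), bijective (phi V h)) /\
    (forall U V (hU : U `<=` W) (hV : V `<=` W) (h : V `<=` U) (s : L U),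
      phi V hV (res h s) = res h (phi U hU s)).

Definition opensT : opens X := Opens openT.

Definition omodule_iso L M : Prop :=
  omodule_iso_over opensT L M.

Lemma osheaf_glue (U : opens X) (I : Type) (V : I -> opens X)
    (h : forall i, V i `<=` U) (s : forall i, (regfun (V i))^o) :
  U `<=` \bigcup_i V i ->
  (forall i j (W : opens X) (hi : W `<=` V i) (hj : W `<=` V j),
    regfun_res hi (s i) = regfun_res hj (s j)) ->
  exists! t : (regfun U)^o, forall i, regfun_res (h i) t = s i.
Proof.
move=> cov compat.
have /choice[c cP] : forall x : U, exists i, opens_set (V i) (val x).
  by move=> x; have [i _ ?] := cov _ (set_valP x); exists i.
pose f (x : U) : k := s (c x) (exist _ (val x) (mem_set (cP x))).
have fE i (y : V i) : f (incl (h i) y) = s i y.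
  set x := incl _ _.
  pose W := Opens (openI (opens_open (V (c x))) (opens_open (V i))).
  have hi : W `<=` V (c x) by move=> ? [].
  have hj : W `<=` V i by move=> ? [].
  have Wy : opens_set W (val y) by split; [exact: (cP x)|exact: set_valP].
  have := compat _ _ W hi hj.
  move/(congr1 (fun g : regfun W => g (exist _ (val y) (mem_set Wy)))) => /= E.
  rewrite /f; transitivity (s (c x) (incl hi (exist _ (val y) (mem_set Wy)))).
    by congr (s (c x) _); apply: val_inj.
  by rewrite E; congr (s i _); apply: val_inj.
have fi i : f \o incl (h i) = s i by apply/funext => y; exact: fE.
have freg : f \in @regularp k X U.
  apply/regularpP/regular_local => x Ux; have [i _ Vx] := cov _ Ux.
  by exists (V i), (h i); split=> //; rewrite fi; exact: regfunP.
exists (RegFun freg); split.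
  by move=> i; apply: val_inj; exact: fi.
move=> t ht; apply: val_inj; apply/funext => x /=.
have [i _ Vx] := cov _ (set_valP x).
have -> : x = incl (h i) (exist _ (val x) (mem_set Vx)) by apply: val_inj.
by rewrite fE -(ht i).
Qed.

(* The structure sheaf, as a module over itself. *)
Program Definition osheaf : omodule X :=
  @OModule k X (fun U => (regfun U)^o) (@regfun_res k X) _ _ _ _ osheaf_glue.
Next Obligation. by move=> U V h s t; exact: (@val_inj _ _ (regfun V)). Qed.
Next Obligation. by move=> U V h a s; exact: (@val_inj _ _ (regfun V)). Qed.
Next Obligation.
move=> U h s; apply: (@val_inj _ _ (regfun U)); apply/funext => x /=.
by congr (_ s _); apply: val_inj.
Qed.
Next Obligation.
move=> U V W h h' h'' s; apply: (@val_inj _ _ (regfun W)); apply/funext => x /=.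
by congr (_ s _); apply: val_inj.
Qed.

(* Locally free of rank 1. *)
Record invertible := Invertible {
  invertible_omodule :> omodule X;
  invertibleP : forall x : X, exists U : opens X,
    opens_set U x /\ omodule_iso_over U osheaf invertible_omodule
}.

Lemma omodule_iso_over_refl W L : omodule_iso_over W L L.
Proof.
exists (fun V _ => idfun : {linear L V -> L V}); split=> //.
Qed.

Definition osheaf_invertible : invertible :=
  @Invertible osheaf (fun _ => ex_intro _ opensT (conj I (omodule_iso_over_refl _ _))).

Definition iso_class (L : invertible) : invertible -> Prop := omodule_iso L.

(* The set of isomorphism classes of invertible sheaves.  The group law, given
   by the tensor product, is not needed to say that the group is trivial. *)
Record Pic := PicClass {
  pic_class :> invertible -> Prop;
  picP : exists L : invertible, pic_class = iso_class L
}.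

(* The neutral element. *)
Definition Pic1 : Pic := PicClass (ex_intro _ osheaf_invertible erefl).

End Picard.

(** * Quasi-projective varieties *)

(* The projective space P^(N-1), as the lines through the origin of k^N. *)
Definition projspace (k : fieldType) (N : nat) : Type :=
  {L : {vspace 'rV[k]_N} | \dim L == 1%N}.

HB.instance Definition _ k N := Choice.on (projspace k N).

Definition hcoord (k : fieldType) N (x : projspace k N) : 'rV[k]_N := vpick (val x).

(* The value at the chosen homogeneous coordinates of x: for homogeneous p and
   q of the same degree, the vanishing of p at x and the ratio p(x)/q(x) do not
   depend on that choice. *)
Definition heval (k : fieldType) N (p : {mpoly k[N]}) (x : projspace k N) : k :=
  p.@[fun i => hcoord x 0 i].

Section Zariski.
Variables (k : fieldType) (N : nat).

Definition homogeneous (p : {mpoly k[N]}) : Prop := exists m, p \is m.-homog.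

Definition zero_locus (S : set {mpoly k[N]}) : set (projspace k N) :=
  [set x | forall p, S p -> heval p x = 0].

Definition zariski_open (U : set (projspace k N)) : Prop :=
  exists2 S, S `<=` homogeneous & U = ~` zero_locus S.

Lemma zariski_openT : zariski_open setT.
Proof.
exists [set 1]; first by move=> _ ->; exists 0%N; exact: dhomog1.
apply/seteqP; split=> // x _ /(_ 1 erefl); rewrite /heval meval1.
by apply/eqP; exact: oner_neq0.
Qed.

Lemma zariski_openP U : zariski_open U <->
  forall x, U x -> exists p, [/\ homogeneous p, heval p x <> 0 &
    forall y, heval p y <> 0 -> U y].
Proof.
split=> [[S hS ->] x /existsNP[p /not_implyP[Sp px]]|hU].
  exists p; split=> [||y py]; [exact: hS|exact: px|by move=> /(_ p Sp)].
exists [set p | homogeneous p /\ forall y, heval p y <> 0 -> U y].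
  by move=> p [].
apply/seteqP; split=> [x /hU[p [hp px pU]] /(_ p (conj hp pU))//|x].
by move=> /existsNP[p /not_implyP[[_ pU] px]]; exact: pU.
Qed.

Lemma zariski_openI : setI_closed zariski_open.
Proof.
move=> U V /zariski_openP hU /zariski_openP hV; apply/zariski_openP => x.
move=> [/hU[p [[m hp] px pU]] /hV[q [[n hq] qx qV]]].
exists (p * q); split; first by exists (m + n)%N; exact: dhomogM.
  by rewrite /heval mevalM; apply/eqP; rewrite mulf_neq0//; exact/eqP.
rewrite /heval => y; rewrite mevalM => /eqP.
by rewrite mulf_eq0 negb_or => /andP[/eqP ? /eqP ?]; split; [exact: pU|exact: qV].
Qed.

Lemma zariski_open_bigU (I : Type) (f : I -> set (projspace k N)) :
  (forall i, zariski_open (f i)) -> zariski_open (\bigcup_i f i).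
Proof.
move=> hf; apply/zariski_openP => x [i _ /((zariski_openP _).1 (hf i))].
by move=> [p [hp px pf]]; exists p; split=> // y /pf; exists i.
Qed.

HB.instance Definition _ := @isOpenTopological.Build (projspace k N)
  zariski_open zariski_openT zariski_openI zariski_open_bigU.

End Zariski.

Section QuasiProjective.
Variables (k : fieldType) (N : nat) (A : set (projspace k N)).

(* Locally a quotient of homogeneous polynomials of the same degree. *)
Definition qproj_regular (U : opens A) : set (U -> k) :=
  [set f | forall x, opens_set U x ->
    exists (V : opens A) (h : V `<=` U), opens_set V x /\
    exists m (p q : {mpoly k[N]}), [/\ p \is m.-homog, q \is m.-homog &
      forall y : V, heval q (val (val y)) != 0 /\
        f (incl h y) = heval p (val (val y)) / heval q (val (val y))]].

Program Definition qproj : fspace k := @FSpace k A qproj_regular _ _ _ _ _.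
Next Obligation.
move=> U c x Ux; exists U, (fun _ => id); split=> //.
exists 0%N, (mpolyC N c), 1; split=> [||y]; rewrite ?dhomog1 //.
  by rewrite -[mpolyC N c]mulr1 mul_mpolyC dhomogZ // dhomog1.
by rewrite /heval meval1 mevalC divr1 oner_eq0.
Qed.
Next Obligation.
move=> U f g hf hg x Ux.
have [V [h [Vx [m [p [q [hp hq E]]]]]]] := hf x Ux.
have [V' [h' [V'x [m' [p' [q' [hp' hq' E']]]]]]] := hg x Ux.
pose W := Opens (openI (opens_open V) (opens_open V')).
have hW : W `<=` U by move=> y [/h].
exists W, hW; split=> //; exists (m + m')%N, (p * q' - p' * q), (q * q').
split; [|exact: dhomogM|].
  by apply: rpredB; [exact: dhomogM | rewrite addnC; exact: dhomogM].
move=> y; have [Vy V'y] := set_valP y.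
have [q0 e] := E (exist _ (val y) (mem_set Vy)).
have [q0' e'] := E' (exist _ (val y) (mem_set V'y)).
rewrite /= in q0 e q0' e'.
rewrite /heval !(mevalB, mevalM) mulf_neq0//; split=> //.
transitivity (f (incl hW y) - g (incl hW y)) => //.
have -> : incl hW y = incl h (exist _ (val y) (mem_set Vy)) by exact: val_inj.
have {2}-> : incl h (exist _ (val y) (mem_set Vy)) =
  incl h' (exist _ (val y) (mem_set V'y)) by exact: val_inj.
rewrite e e'.
by rewrite -mulNr addf_div // mulNr.
Qed.
Next Obligation.
move=> U f g hf hg x Ux.
have [V [h [Vx [m [p [q [hp hq E]]]]]]] := hf x Ux.
have [V' [h' [V'x [m' [p' [q' [hp' hq' E']]]]]]] := hg x Ux.
pose W := Opens (openI (opens_open V) (opens_open V')).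
have hW : W `<=` U by move=> y [/h].
exists W, hW; split=> //; exists (m + m')%N, (p * p'), (q * q').
split; [exact: dhomogM|exact: dhomogM|].
move=> y; have [Vy V'y] := set_valP y.
have [q0 e] := E (exist _ (val y) (mem_set Vy)).
have [q0' e'] := E' (exist _ (val y) (mem_set V'y)).
rewrite /= in q0 e q0' e'.
rewrite /heval !mevalM mulf_neq0//; split=> //.
transitivity (f (incl hW y) * g (incl hW y)) => //.
have -> : incl hW y = incl h (exist _ (val y) (mem_set Vy)) by exact: val_inj.
have {2}-> : incl h (exist _ (val y) (mem_set Vy)) =
  incl h' (exist _ (val y) (mem_set V'y)) by exact: val_inj.
rewrite e e'.
by rewrite mulf_div.
Qed.
Next Obligation.
move=> U V h f hf x Vx.
have [V' [h' [V'x [m [p [q [hp hq E]]]]]]] := hf x (h _ Vx).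
pose W := Opens (openI (opens_open V) (opens_open V')).
have hW : W `<=` V by move=> y [].
exists W, hW; split=> //; exists m, p, q; split=> // y.
have [_ V'y] := set_valP y.
have [q0 e] := E (exist _ (val y) (mem_set V'y)); split=> //.
by rewrite -[RHS]e /=; congr (f _); exact: val_inj.
Qed.
Next Obligation.
move=> U f hf x Ux; have [V [h [Vx hV]]] := hf x Ux.
have [W [h' [Wx [m [p [q [hp hq E]]]]]]] := hV x Vx.
have hW : W `<=` U by move=> y /h'/h.
exists W, hW; split=> //; exists m, p, q; split=> // y.
have [q0 e] := E y; split=> //.
by rewrite -[RHS]e /=; congr (f _); exact: val_inj.
Qed.

End QuasiProjective.

(** * Geometric quotients

    The quotient set with the quotient topology, a function on an open subset
    being regular when its pull-back is: the regular functions on U are the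
    invariant regular functions on the inverse image of U. *)

Section Quotient.
Variables (k : fieldType) (X : fspace k) (e : equiv_rel X).

Definition quot_top : topologicalType := quotient_topology {eq_quot e}.

Definition quot_pi : X -> quot_top := \pi_{eq_quot e}.

Definition quot_preimage (U : opens quot_top) : opens X :=
  @Opens X (quot_pi @^-1` U) (opens_open U).

Definition quot_pullback (U : opens quot_top) (f : U -> k) :
    quot_preimage U -> k :=
  f \o @submap _ _ quot_pi (quot_preimage U) U (fun _ => id).

Program Definition geom_quot : fspace k :=
  @FSpace k quot_top (fun U f => regular_on (quot_pullback f)) _ _ _ _ _.
Next Obligation. by move=> U c; exact: regular_cst. Qed.
Next Obligation. by move=> U f g; exact: regularB. Qed.
Next Obligation. by move=> U f g; exact: regularM. Qed.
Next Obligation.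
move=> U V h f hf.
have h' : quot_preimage V `<=` quot_preimage U by move=> x /h.
rewrite (_ : quot_pullback _ = quot_pullback f \o incl h').
  exact: regular_restr.
by apply/funext => x /=; congr (f _); exact: val_inj.
Qed.
Next Obligation.
move=> U f hf; apply: regular_local => x Ux.
have [V [h [Vx hV]]] := hf _ Ux.
have h' : quot_preimage V `<=` quot_preimage U by move=> y /h.
exists (quot_preimage V), h'; split=> //.
rewrite (_ : _ \o _ = quot_pullback (f \o incl h)) //.
by apply/funext => y /=; congr (f _); exact: val_inj.
Qed.

End Quotient.

(** * Rational maps and their conjugation *)

Section RationalMaps.
Variables (k : closedFieldType) (d : nat).
Implicit Types (F G : 'rV[k]_d.+1) (f g : 'M[k]_2).

(* F stands for the binary form \sum_i F_i X^i Y^(d-i). *)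
Definition bform_eval (B : comAlgType k) F (x y : B) : B :=
  \sum_(i < d.+1) F 0 i *: (x ^+ i * y ^+ (d - i)).

(* Rows of the Sylvester matrix of a pair of binary forms of degree d: row i is
   X^i F. The size is 2d even when the X-degrees of F and G drop, hence the
   determinant vanishes if and only if F and G have a common zero in P^1. *)
Definition bform_band F : 'M[k]_(d, d + d) :=
  \matrix_(i, j) (rVpoly F * 'X^i)`_j.

Definition bform_resultant F G : k :=
  \det (col_mx (bform_band F) (bform_band G)).

(* F(aX + bY, cX + eY) for f = [a, b; c, e], computed at Y = 1. *)
Definition bform_subst f F : 'rV[k]_d.+1 :=
  poly_rV (bform_eval F (f 0 0 *: 'X + (f 0 1)%:P) (f 1 0 *: 'X + (f 1 1)%:P)).

(* The coefficient vectors of F and G, put side by side, represent [F : G]; the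
   conjugate of phi = [F : G] by f = [a, b; c, e] in SL_2 is
   f^-1 o phi o f = [e F' - b G' : a G' - c F'] with F' = F o f, G' = G o f. *)
Definition conj_pair f (v : 'rV[k]_(d.+1 + d.+1)) : 'rV[k]_(d.+1 + d.+1) :=
  let F' := bform_subst f (lsubmx v) in
  let G' := bform_subst f (rsubmx v) in
  row_mx (f 1 1 *: F' - f 0 1 *: G') (f 0 0 *: G' - f 1 0 *: F').

Definition Rat_set : set (projspace k (d.+1 + d.+1)) :=
  [set x | bform_resultant (lsubmx (hcoord x)) (rsubmx (hcoord x)) != 0].

Definition Rat_space : fspace k := qproj Rat_set.

Local Notation heval_poly n P A B :=
  (\sum_(i < n.+1) P`_i *: (A ^+ i * B ^+ (n - i))).

Lemma bform_eval_polyM (B : comAlgType k) (x y : B) m n (P Q : {poly k}) :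
  (size P <= m.+1)%N -> (size Q <= n.+1)%N ->
  heval_poly (m + n) (P * Q) x y = heval_poly m P x y * heval_poly n Q x y.
Proof.
move=> sP sQ; pose h (R : {poly k}) := heval_poly (m + n) R x y.
have hD : {morph h : R S / R + S}.
  move=> R S; rewrite /h -big_split; apply: eq_bigr => i _.
  by rewrite coefD scalerDl.
have h0 : h 0 = 0 by rewrite /h big1// => i _; rewrite coef0 scale0r.
have hZ c R : h (c *: R) = c *: h R.
  rewrite /h scaler_sumr; apply: eq_bigr => i _.
  by rewrite coefZ scalerA.
have hX e : (e <= m + n)%N -> h 'X^e = x ^+ e * y ^+ (m + n - e).
  move=> le; rewrite /h (bigD1 (Ordinal (le : e < (m + n).+1)%N)) //=.
  rewrite coefXn eqxx scale1r big1 ?addr0 // => i /negbTE ne.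
  by rewrite coefXn -val_eqE /= in ne *; rewrite ne scale0r.
have toX j (R : {poly k}) : (size R <= j.+1)%N ->
    R = \sum_(i < j.+1) R`_i *: 'X^i.
  move=> sR; rewrite -poly_def; apply/polyP => i; rewrite coef_poly.
  by case: ltnP => // le; rewrite nth_default // (leq_trans sR).
rewrite -/(h _) {1}(toX _ _ sP) {1}(toX _ _ sQ) mulr_suml (big_morph h hD h0).
rewrite mulr_suml; apply: eq_bigr => i _.
rewrite mulr_sumr (big_morph h hD h0) mulr_sumr; apply: eq_bigr => j _.
rewrite -scalerAl -scalerAr !hZ -exprD hX; last first.
  by apply: leq_add; rewrite -(ltnS _ _).
rewrite -scalerAl -scalerAr; congr (_ *: (_ *: _)).
rewrite mulrACA -!exprD; congr (_ * _ ^+ _).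
have [li lj] : (i <= m)%N /\ (j <= n)%N by rewrite -!(ltnS _ m) -!(ltnS _ n).
by rewrite addnBA // addnBAC // subnDA.
Qed.

Lemma size_lin (a b : k) : (size (a *: 'X + b%:P : {poly k})%R <= 2)%N.
Proof.
rewrite (leq_trans (size_polyD _ _)) // geq_max.
rewrite (leq_trans (size_scale_leq _ _)) ?size_polyX //.
by rewrite (leq_trans (size_polyC_leq1 _)).
Qed.

Lemma size_linX (a b : k) n : (size ((a *: 'X + b%:P : {poly k}) ^+ n)%R <= n.+1)%N.
Proof.
rewrite (leq_trans (size_poly_exp_leq _ _)) // ltnS -[leqRHS]mul1n leq_mul2r.
by rewrite -subn1 leq_subLR size_lin orbT.
Qed.

Lemma bform_eval_linX (B : comAlgType k) (x y : B) (a b : k) n :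
  heval_poly n ((a *: 'X + b%:P) ^+ n) x y = (a *: x + b *: y) ^+ n.
Proof.
elim: n => [|n IH].
  by rewrite big_ord1 !expr0 coef1 scale1r mulr1.
have := bform_eval_polyM x y (size_lin a b) (size_linX a b n).
rewrite add1n -exprS => ->; rewrite IH exprS; congr (_ * _).
rewrite big_ord_recl big_ord1 /= !coefD !coefZ !coefX !coefC /=.
by rewrite !mulr0 add0r mulr1 addr0 !expr0 !expr1 mul1r mulr1 addrC.
Qed.

Lemma bform_eval_subst (B : comAlgType k) f F (x y : B) :
  bform_eval (bform_subst f F) x y =
  bform_eval (B := B) F (f 0 0 *: x + f 0 1 *: y) (f 1 0 *: x + f 1 1 *: y).
Proof.
set p := bform_eval F (f 0 0 *: 'X + (f 0 1)%:P) (f 1 0 *: 'X + (f 1 1)%:P).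
have sp : (size p <= d.+1)%N.
  rewrite /p /bform_eval (leq_trans (size_sum _ _ _)) //; apply/bigmax_leqP => i _.
  rewrite (leq_trans (size_scale_leq _ _)) // (leq_trans (size_polyMleq _ _)) //.
  have := leq_add (size_linX (f 0 0) (f 0 1) i) (size_linX (f 1 0) (f 1 1) (d - i)).
  by rewrite addSn addnS subnKC; last (by rewrite -(ltnS _ d)); case: (_ + _)%N.
transitivity (heval_poly d p x y).
  apply: eq_bigr => i _; congr (_ *: _).
  by rewrite -(poly_rV_K sp) coef_rVpoly_ord.
rewrite /p /bform_eval.
under eq_bigr do rewrite coef_sum scaler_suml.
rewrite exchange_big; apply: eq_bigr => j _ /=.
under eq_bigr do rewrite coefZ -scalerA.
rewrite -scaler_sumr; congr (_ *: _).
have le : (j <= d)%N by rewrite -ltnS.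
have := bform_eval_polyM x y (size_linX (f 0 0) (f 0 1) j) (size_linX (f 1 0) (f 1 1) (d - j)).
by rewrite subnKC // !bform_eval_linX.
Qed.

Lemma mulmx2E f g i j : (f *m g) i j = f i 0 * g 0 j + f i 1 * g 1 j.
Proof.
rewrite mxE big_ord_recl big_ord1.
by rewrite (_ : lift ord0 ord0 = 1) //; apply: val_inj.
Qed.

Lemma bform_substM f g F :
  bform_subst g (bform_subst f F) = bform_subst (f *m g) F.
Proof.
rewrite {1}/bform_subst bform_eval_subst /bform_subst.
have E i : f i 0 *: (g 0 0 *: 'X + (g 0 1)%:P) + f i 1 *: (g 1 0 *: 'X + (g 1 1)%:P)
    = (f *m g) i 0 *: 'X + ((f *m g) i 1)%:P.
  rewrite !mulmx2E !scalerDr !scalerA -!mul_polyC -!polyCM !polyCD !mulrDl.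
  by rewrite addrACA.
by rewrite !E.
Qed.

Lemma bform_subst1 F : bform_subst 1%:M F = F.
Proof.
rewrite /bform_subst !mxE /= !scale1r !scale0r addr0 add0r -[RHS]rVpolyK.
congr poly_rV; rewrite -[RHS]coefK poly_def; apply/esym.
rewrite (big_ord_widen d.+1 (fun i => (rVpoly F)`_i *: 'X^i)) ?size_poly //.
rewrite big_mkcond; apply: eq_bigr => i _ /=.
rewrite coef_rVpoly_ord expr1n mulr1; case: ltnP => // le.
by rewrite -(coef_rVpoly_ord F) nth_default // scale0r.
Qed.

Lemma bform_subst_is_linear f : linear (bform_subst f).
Proof.
move=> a F G; rewrite /bform_subst -linearP; congr poly_rV.
rewrite /bform_eval scaler_sumr -big_split; apply: eq_bigr => i _ /=.
by rewrite !mxE scalerDl scalerA.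
Qed.

HB.instance Definition _ f := GRing.isLinear.Build _ _ _ _ (bform_subst f)
  (bform_subst_is_linear f).

Lemma conj_pair1 (v : 'rV[k]_(d.+1 + d.+1)) : conj_pair 1%:M v = v.
Proof.
rewrite /conj_pair !bform_subst1 !mxE /= !scale1r !scale0r !subr0.
exact: hsubmxK.
Qed.

Lemma conj_pairM f g (v : 'rV[k]_(d.+1 + d.+1)) :
  conj_pair g (conj_pair f v) = conj_pair (f *m g) v.
Proof.
rewrite /conj_pair !row_mxKl !row_mxKr !linearB !linearZ /= !bform_substM.
move: (bform_subst _ _) (bform_subst _ _) => F G.
rewrite !mulmx2E; congr row_mx; apply/rowP => i; rewrite !mxE.
  by ring.
by ring.
Qed.

Lemma conj_pairZ f (c : k) (v : 'rV[k]_(d.+1 + d.+1)) :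
  conj_pair f (c *: v) = c *: conj_pair f v.
Proof.
rewrite /conj_pair !linearZ /= scale_row_mx.
by congr row_mx; apply/rowP => i; rewrite !mxE; ring.
Qed.

Lemma vlineZ (V : vectType k) (c : k) (w : V) : c != 0 -> <[c *: w]>%VS = <[w]>%VS.
Proof.
move=> c0; apply/eqP; rewrite eqEsubv -!memvE rpredZ ?memv_line //=.
by rewrite -{1}[w]scale1r -(mulVf c0) -scalerA rpredZ // memv_line.
Qed.

Lemma hcoord_neq0 (N : nat) (x : projspace k N) : hcoord x != 0.
Proof. by rewrite vpick0 -dimv_eq0 (eqP (valP x)). Qed.

Lemma hcoordK (N : nat) (x : projspace k N) : <[hcoord x]>%VS = val x.
Proof.
apply/eqP; rewrite eqEdim -memvE memv_pick dim_vline hcoord_neq0.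
by rewrite (eqP (valP x)).
Qed.

Lemma hcoordP (N : nat) (x : projspace k N) (w : 'rV[k]_N) :
  val x = <[w]>%VS -> exists2 c, c != 0 & hcoord x = c *: w.
Proof.
move=> E; have /vlineP[c cE] : hcoord x \in <[w]>%VS by rewrite -E memv_pick.
exists c => //; apply: contra_neq (hcoord_neq0 x) => c0.
by rewrite cE c0 scale0r.
Qed.

(* The orbit relation of the action of SL_2 on Rat_d. Both x and y are assumed to
   lie in Rat_d, so its stability under the action is not needed here. *)
Definition ratmap_conj (x y : Rat_space) : Prop :=
  exists2 f : 'M[k]_2, \det f = 1 &
    val (val y) = <[conj_pair f (hcoord (val x))]>%VS.

Lemma ratmap_conj_equiv : equiv_class_of (fun x y => `[< ratmap_conj x y >]).
Proof.
split=> [x|x y|y x z].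
- by apply/asboolP; exists 1%:M; rewrite ?det1 // conj_pair1 hcoordK.
- suff imp (u v : Rat_space) : ratmap_conj u v -> ratmap_conj v u.
    by apply/asboolP/asboolP; exact: imp.
  move=> [f det_f /hcoordP[c c0 E]].
  have f_unit : f \in unitmx by rewrite unitmxE det_f unitr1.
  exists (invmx f); first by rewrite det_inv det_f invr1.
  by rewrite E conj_pairZ conj_pairM mulmxV // conj_pair1 vlineZ // hcoordK.
- move=> /asboolP[f det_f /hcoordP[c c0 E]] /asboolP[g det_g E'].
  apply/asboolP; exists (f *m g); first by rewrite det_mulmx det_f det_g mulr1.
  by rewrite E' E conj_pairZ conj_pairM vlineZ.
Qed.

Definition ratmap_conj_rel : equiv_rel Rat_space :=
  EquivRelPack ratmap_conj_equiv.

Definition M_space : fspace k := geom_quot ratmap_conj_rel.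

End RationalMaps.

(* Main.v *)
(** Pulling an invertible sheaf on M_d back to the affine cone over Rat_d gives a
    multiplicative cocycle G_ij of regular functions on open sets of k^(2d+2).
    Fixing an index i0, each G_(i i0) is a rational function r_i, and the orders of
    the r_i along irreducible hypersurfaces patch to a divisor.  Polynomial rings
    being factorial, this is the divisor of a homogeneous fraction h, so the
    T_i = r_i / h have no zeros or poles, satisfy T_i = G_ij T_j, and are
    homogeneous of a common weight m.

    Along the orbit of a unipotent one-parameter subgroup of SL_2, T_i is a unit of
    the affine line, hence constant: T_i is SL_2-invariant.  If an element of SL_2
    multiplies the coefficient vector v by c, then T_i(v) = T_i(cv) = c^m T_i(v), so
    c^m = 1.  For [X^d + Y^d : X^(d-1) Y] and diag(t, 1/t) with t a primitive 2d-th
    root of unity, c is t^(d-1); for [X^d : Y^d] one can have c = -1.  Together they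
    force 2d | m.  Dividing the T_i by a power of the resultant, which is invariant
    of weight 2d and has no zeros on Rat_d, gives functions that descend to M_d and
    trivialize the sheaf. *)

From HB Require Import structures.
Require Import Defs.
From mathcomp Require Import all_boot all_order all_algebra.
From mathcomp Require Import cyclic separable cyclotomic.
From mathcomp Require Import generic_quotient.
From mathcomp Require Import boolp classical_sets.
From mathcomp Require Import topology_structure.
From mathcomp Require Import mpoly ring zify.

Set Implicit Arguments.
Unset Strict Implicit.
Unset Printing Implicit Defensive.

Import GRing.Theory.
Local Open Scope ring_scope.
Local Open Scope quotient_scope.

(** * Unique factorization in polynomial rings *)

(** The cone over Rat_d is a principal open subset of affine space, so unique factorization
    trivializes the sheaf there; the group Pic(Rat_d), cyclic of order 2d, survives only as the
    weight m. Its modulus 2d is the degree of the resultant: the Sylvester matrix has d rows for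
    each of the two forms. Two special maps are needed because the first gives only 2d | (d-1)m. As
    gcd(d-1, 2d) divides 2, this settles even d, but for odd d it leaves d | m, and the second map
    supplies the parity. Divisors occur only as orders of polynomials along prime elements, and the
    geometric input is that a prime p not dividing F has a zero outside F = 0. No local structure of
    the quotient is involved: regularity on M_d is by definition regularity after pull-back to
    Rat_d, so invariance is all that descent requires. Characteristic 0 provides the primitive roots
    of unity and -1 != 1. *)

Section Factoriality.
Variable R : idomainType.
Implicit Types a b c p q u v : R.

Definition rdvd a b := exists c, b = c * a.

Definition rprime p :=
  [/\ p != 0, ~ rdvd p 1 & forall a b, rdvd p (a * b) -> rdvd p a \/ rdvd p b].

(** Prime rather than irreducible factors are asked for, so that uniqueness is built into existence.
    The index counts the primes and serves as induction measure. *)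
Inductive factored : nat -> R -> Prop :=
| Factored_unit u v : u * v = 1 -> factored 0 u
| Factored_mul n p a : rprime p -> factored n a -> factored n.+1 (p * a).

Definition factorial_ring := forall a, a != 0 -> exists n, factored n a.

Lemma rdvd_mull a b c : rdvd a b -> rdvd a (c * b).
Proof. by move=> [x ->]; exists (c * x); rewrite mulrA. Qed.

Lemma rdvd_mulr a b c : rdvd a b -> rdvd a (b * c).
Proof. by rewrite mulrC; exact: rdvd_mull. Qed.

Lemma rdvd_trans a b c : rdvd a b -> rdvd b c -> rdvd a c.
Proof. by move=> ab [x ->]; exact: rdvd_mull. Qed.

Lemma rdvd_refl a : rdvd a a.
Proof. by exists 1; rewrite mul1r. Qed.

Lemma rdvd0 a : rdvd a 0.
Proof. by exists 0; rewrite mul0r. Qed.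

Lemma rdvdD a b c : rdvd a b -> rdvd a c -> rdvd a (b + c).
Proof. by move=> [x ->] [y ->]; exists (x + y); rewrite mulrDl. Qed.

Lemma rdvdN a b : rdvd a b -> rdvd a (- b).
Proof. by move=> [x ->]; exists (- x); rewrite mulNr. Qed.

Lemma rdvd_sum a (I : Type) (r : seq I) (P : pred I) (F : I -> R) :
  (forall i, P i -> rdvd a (F i)) -> rdvd a (\sum_(i <- r | P i) F i).
Proof. by move=> h; apply: big_ind => //; [exact: rdvd0 | exact: rdvdD]. Qed.

Lemma rprime_neq0 p : rprime p -> p != 0.
Proof. by case. Qed.

Lemma rprime_mul p a b : rprime p -> rdvd p (a * b) -> rdvd p a \/ rdvd p b.
Proof. by case=> _ _; exact. Qed.

Lemma rprime_ndvd_unit p u v : rprime p -> u * v = 1 -> ~ rdvd p u.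
Proof. by case=> _ p1 _ uv pu; apply: p1; rewrite -uv; exact: rdvd_mulr. Qed.

Lemma factored_neq0 n a : factored n a -> a != 0.
Proof.
elim=> [u v uv|m p b pp _ b0]; last by rewrite mulf_neq0 // rprime_neq0.
by apply: contra_eq_neq uv => ->; rewrite mul0r eq_sym oner_eq0.
Qed.

Lemma factoredM n m a b : factored n a -> factored m b -> factored (n + m) (a * b).
Proof.
move=> + fb; elim=> [u v uv|{}n p c pp _ IH].
  elim: fb => [u' v' uv'|k p c pp _ IH].
    by apply: (@Factored_unit _ (v * v')); rewrite mulrACA uv uv' mulr1.
  by rewrite mulrCA; exact: Factored_mul.
by rewrite addSn -mulrA; exact: Factored_mul.
Qed.

Lemma factored_prime p : rprime p -> factored 1 p.
Proof.
move=> pp; rewrite -[p]mulr1; apply: Factored_mul => //.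
by apply: (@Factored_unit _ 1); rewrite mulr1.
Qed.

Lemma rprime_assoc p q : rprime p -> rprime q -> rdvd p q ->
  exists u v, u * v = 1 /\ q = u * p.
Proof.
move=> pp pq [u e]; exists u.
have /(rprime_mul pq)[[w ew]|[w ew]] : rdvd q (u * p).
- by rewrite -e; exact: rdvd_refl.
- case: pp => p0 p1 _; case: p1; exists w.
  apply: (mulfI (rprime_neq0 pq)).
  by rewrite mulr1 {1}e ew; ring.
exists w; split=> //; apply: (mulfI (rprime_neq0 pq)).
by rewrite mulr1 {2}e ew; ring.
Qed.

(** The prime [p] is associate to one of the listed primes; removing that one lowers the count by
    exactly one, and the unit goes into the cofactor. *)
Lemma factored_divp n a p b : rprime p -> factored n a -> a = p * b ->
  exists2 m, n = m.+1 & factored m b.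
Proof.
move=> pp fa; elim: fa b => [u v uv|m q c pq fc IH] b e.
  by case: (rprime_ndvd_unit pp uv); rewrite e; exists b; rewrite mulrC.
have /(rprime_mul pp)[|] : rdvd p (q * c) by rewrite e; exists b; rewrite mulrC.
- move=> /(rprime_assoc pp pq)[u [v [uv qe]]]; exists m => //.
  have -> : b = u * c.
    by apply: (mulfI (rprime_neq0 pp)); rewrite -e qe; ring.
  by rewrite -[m]add0n; apply: factoredM => //; exact: (Factored_unit uv).
- move=> [c' ec]; have [m' -> fc'] := IH c' (etrans ec (mulrC _ _)).
  exists m'.+1 => //; have -> : b = q * c'.
    by apply: (mulfI (rprime_neq0 pp)); rewrite -e ec; ring.
  exact: Factored_mul.
Qed.

End Factoriality.

(** * Gauss's lemma and univariate polynomials over a factorial ring *)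

Section FactorialPoly.
Variable R : idomainType.
Hypothesis facR : factorial_ring R.
Implicit Types (c : R) (p q F G : {poly R}).

Lemma rdvd_polyC c p : rdvd c%:P p <-> forall i, rdvd c p`_i.
Proof.
split=> [[q ->] i|]; first by rewrite coefMC; exists q`_i.
move=> /choice[f fE]; exists (\poly_(i < size p) f i); apply/polyP => i.
rewrite coefMC coef_poly; case: ltnP => // le.
by rewrite nth_default // mul0r.
Qed.

(** If the coefficients of index [i] in [F] and [j] in [G] are the first ones that [c] does not
    divide, their product is, modulo [c], the coefficient of index [i + j] in [F * G]. *)
Lemma rprime_polyC c : rprime c -> rprime c%:P.
Proof.
move=> pc; split=> [||F G FG].
- by rewrite polyC_eq0 (rprime_neq0 pc).
- move=> /rdvd_polyC/(_ 0%N); rewrite coef1; by case: pc.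
have [?|/rdvd_polyC/existsNP[i0 /asboolPn Fi]] := pselect (rdvd c%:P F); first by left.
have [?|/rdvd_polyC/existsNP[j0 /asboolPn Gj]] := pselect (rdvd c%:P G); first by right.
have exF : exists i, ~~ `[< rdvd c F`_i >] by exists i0.
have exG : exists i, ~~ `[< rdvd c G`_i >] by exists j0.
case: (ex_minnP exF) => i /asboolPn {}Fi mi; case: (ex_minnP exG) => j /asboolPn {}Gj mj.
have := (rdvd_polyC c (F * G)).1 FG (i + j)%N.
have lt : (i < (i + j).+1)%N by rewrite ltnS leq_addr.
rewrite coefM (bigD1 (Ordinal lt)) //= addKn => h.
suff : rdvd c (F`_i * G`_j) by move=> /(rprime_mul pc)[].
have /rdvdN h' : rdvd c (\sum_(l < (i + j).+1 | l != Ordinal lt) F`_l * G`_(i + j - l)).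
  apply: rdvd_sum => l; rewrite -val_eqE /= neq_ltn => /orP[li|il].
    apply: rdvd_mulr; apply: contrapT => /asboolPn/mi.
    by rewrite leqNgt li.
  apply: rdvd_mull; apply: contrapT => /asboolPn/mj.
  have lij : (l <= i + j)%N := ltn_ord l.
  by rewrite leqNgt ltn_subLR // (ltn_add2r j i l) il.
by have := rdvdD h h'; rewrite addrK.
Qed.

Lemma factored_polyC n c : factored n c -> factored n c%:P.
Proof.
elim=> [u v uv|m p a pp _ IH].
  by apply: (@Factored_unit _ _ v%:P); rewrite -polyCM uv.
by rewrite polyCM; apply: Factored_mul => //; exact: rprime_polyC.
Qed.

Definition primitive p := forall c, rprime c -> ~ rdvd c%:P p.

(** Each constant prime that is extracted also leaves the leading coefficient, whose number of prime
    factors bounds the process. *)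
Lemma primitive_part p : p != 0 -> exists n c q,
  [/\ factored n c, p = c%:P * q & primitive q].
Proof.
rewrite -lead_coef_eq0 => /facR[n]; elim: n p => [|n IH] p fp.
  have [q|/existsNP[c /not_implyP[pc /contrapT]]] := pselect (primitive p).
    exists 0%N, 1, p; split=> //; last by rewrite mul1r.
    by apply: (@Factored_unit _ _ 1); rewrite mulr1.
  move=> [q pE]; have [] // := factored_divp (b := lead_coef q) pc fp.
  by rewrite pE lead_coefM lead_coefC mulrC.
have [q|/existsNP[c /not_implyP[pc /contrapT]]] := pselect (primitive p).
  exists 0%N, 1, p; split=> //; last by rewrite mul1r.
  by apply: (@Factored_unit _ _ 1); rewrite mulr1.
move=> [q pE]; have [|m [<-] /IH] := factored_divp (b := lead_coef q) pc fp.
  by rewrite pE lead_coefM lead_coefC mulrC.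
move=> [k [c' [q' [fc' qE prim]]]]; exists k.+1, (c * c'), q'; split=> //.
  exact: Factored_mul.
by rewrite pE qE polyCM; ring.
Qed.

(** Clears denominators in a factorization over the fraction field: by Gauss's lemma each prime of
    [c] divides [F] or [G] and is cancelled there, which keeps the sizes. *)
Lemma cancel_factored n c p F G : factored n c -> c%:P * p = F * G ->
  exists F' G', [/\ p = F' * G', size F' = size F & size G' = size G].
Proof.
move=> fc; elim: fc F G => [u v uv|{}n q a pq _ IH] F G e.
  exists (v%:P * F), G; split=> //.
    by rewrite -mulrA -e mulrA -polyCM [v * u]mulrC uv mul1r.
  rewrite mul_polyC size_scale //; apply: contra_eq_neq uv => ->.
  by rewrite mulr0 eq_sym oner_eq0.
have q0 : q%:P != 0 by rewrite polyC_eq0 rprime_neq0.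
have /(rprime_mul (rprime_polyC pq)) : rdvd q%:P (F * G).
  by rewrite -e polyCM -mulrA; exists (a%:P * p); rewrite mulrC.
case=> [] [H HE].
  have [|F' [G' [-> sF sG]]] := IH H G.
    by apply: (mulfI q0); rewrite mulrA -polyCM e HE; ring.
  by exists F', G'; split=> //; rewrite sF HE mulrC mul_polyC size_scale // rprime_neq0.
have [|F' [G' [-> sF sG]]] := IH F H.
  by apply: (mulfI q0); rewrite mulrA -polyCM e HE; ring.
by exists F', G'; split=> //; rewrite sG HE mulrC mul_polyC size_scale // rprime_neq0.
Qed.

Lemma cancel_primitive n c p F G : factored n c -> primitive p ->
  c%:P * F = p * G -> rdvd p F.
Proof.
move=> fc pp; elim: fc G => [u v uv|{}n q a pq _ IH] G e.
  exists (v%:P * G); rewrite -mulrA [G * p]mulrC -e mulrA -polyCM.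
  by rewrite [v * u]mulrC uv mul1r.
have q0 : q%:P != 0 by rewrite polyC_eq0 rprime_neq0.
have /(rprime_mul (rprime_polyC pq)) : rdvd q%:P (p * G).
  by rewrite -e polyCM -mulrA; exists (a%:P * F); rewrite mulrC.
case=> [/pp //|[H HE]].
by apply: (IH H); apply: (mulfI q0); rewrite mulrA -polyCM e HE; ring.
Qed.

(** [%|] is divisibility up to a nonzero constant, that is, over the fraction field; primitivity of
    [p] lets that constant be cancelled prime by prime. *)
Lemma dvdp_primitive p F : primitive p -> p %| F -> rdvd p F.
Proof.
move=> pp /Pdiv.Idomain.dvdpP[[c q] /= c0 e]; have [n fc] := facR c0.
by apply: (cancel_primitive fc pp (G := q)); rewrite mul_polyC e mulrC.
Qed.

(** The gcd of [p] and [F] exists over the fraction field. Cleared of denominators it gives a factor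
    of [p] of the same size, so irreducibility makes it a constant or an associate of [p]. *)
Lemma primitive_irreducible p : primitive p -> (1 < size p)%N ->
  (forall F G, p = F * G -> size F = 1%N \/ size G = 1%N) -> rprime p.
Proof.
move=> pp sp irr; have p0 : p != 0 by rewrite -size_poly_gt0 ltnW.
split=> // [[q e]|F G FG].
  have q0 : q != 0 by apply: contra_eq_neq e => ->; rewrite mul0r oner_eq0.
  have := congr1 (fun r : {poly R} => size r) e; rewrite size_mul // size_poly1.
  have : (0 < size q)%N by rewrite size_poly_gt0.
  by case: (size q) (size p) sp => [|m] [|[|l]] // _ _; rewrite addSn !addnS.
have [cop|ncop] := boolP (coprimep p F).
  right; apply: (dvdp_primitive pp).
  rewrite -(Gauss_dvdpr _ cop); case: FG => H ->; exact: dvdp_mulIr.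
left; apply: (dvdp_primitive pp).
have [[c q] /= c0 e] := Pdiv.Idomain.dvdpP _ _ (dvdp_gcdl p F).
have [n fc] := facR c0.
have [|p1 [p2 [pE s1 s2]]] := cancel_factored (p := p) (F := q) (G := gcdp p F) fc.
  by rewrite mul_polyC e.
rewrite (@eqp_dvdl _ (gcdp p F) p) ?dvdp_gcdr //.
rewrite eqp_sym -dvdp_size_eqp ?dvdp_gcdl // -s2.
have [h|h] := irr _ _ pE; last by rewrite /coprimep -s2 h in ncop.
have p20 : p2 != 0 by apply: contraNneq p0 => e2; rewrite pE e2 mulr0.
have p10 : p1 != 0 by apply: contraNneq p0 => e2; rewrite pE e2 mul0r.
by rewrite pE size_mul // h.
Qed.

Lemma factorial_poly : factorial_ring {poly R}.
Proof.
move=> p; have [N] := ubnP (size p); elim: N p => // N IH p lt p0.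
have [n [c [q [fc pE pq]]]] := primitive_part p0.
have c0 : c != 0 := factored_neq0 fc.
have sq : size q = size p by rewrite pE mul_polyC size_scale.
have q0 : q != 0 by rewrite -size_poly_gt0 sq size_poly_gt0.
suff [m fq] : exists m, factored m q.
  by exists (n + m)%N; rewrite pE; apply: factoredM => //; exact: factored_polyC.
have [le1|gt1] := leqP (size q) 1.
  have /size1_polyC qE := le1; rewrite qE.
  have [m fm] : exists m, factored m q`_0.
    by apply: facR; apply: contraNneq q0 => e; rewrite qE e.
  by exists m; exact: factored_polyC.
have [irr|/existsNP[F /existsNP[G /not_implyP[e /not_orP[sF sG]]]]] := 
  pselect (forall F G, q = F * G -> size F = 1%N \/ size G = 1%N).
  by exists 1%N; apply: factored_prime; exact: primitive_irreducible.
have F0 : F != 0 by apply: contraNneq q0 => e2; rewrite e e2 mul0r.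
have G0 : G != 0 by apply: contraNneq q0 => e2; rewrite e e2 mulr0.
have sFG : size q = (size F + size G).-1 by rewrite e size_mul.
have [pF pG] : (0 < size F)%N /\ (0 < size G)%N by rewrite !size_poly_gt0.
have [sF1 sG1] : (1 < size F)%N /\ (1 < size G)%N.
  by split; rewrite ltn_neqAle eq_sym; [rewrite pF|rewrite pG]; rewrite andbT; apply/eqP.
rewrite ltnS -sq sFG in lt.
have [m1 f1] : exists m, factored m F.
  apply: IH => //; apply: leq_trans lt.
  by rewrite -(prednK pG) addnS /= -{1}[size F]addn0 ltn_add2l -ltnS prednK.
have [m2 f2] : exists m, factored m G.
  apply: IH => //; apply: leq_trans lt.
  by rewrite -(prednK pF) addSn /= -{1}[size G]add0n ltn_add2r -ltnS prednK.
by exists (m1 + m2)%N; rewrite e; exact: factoredM.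
Qed.

End FactorialPoly.

Section FactorialIso.
Variables (R S : idomainType) (f : {rmorphism R -> S}) (g : {rmorphism S -> R}).
Hypotheses (fK : cancel f g) (gK : cancel g f).

Lemma rdvd_iso a b : rdvd (f a) (f b) <-> rdvd a b.
Proof.
split=> [[c e]|[c ->]]; last by exists (f c); rewrite rmorphM.
by exists (g c); rewrite -[b]fK e rmorphM fK.
Qed.

Lemma rprime_iso p : rprime (f p) <-> rprime p.
Proof.
have f1 : f 1 = 1 by exact: rmorph1.
have f0 a : (f a == 0) = (a == 0) by rewrite -(rmorph0 f) (can_eq fK).
split=> -[p0 p1 pM]; split.
- by rewrite -f0.
- by move=> /rdvd_iso; rewrite f1.
- by move=> a b /rdvd_iso; rewrite rmorphM => /pM[] /rdvd_iso; [left|right].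
- by rewrite f0.
- by rewrite -f1 => /rdvd_iso.
- move=> a b; rewrite -[a]gK -[b]gK -rmorphM => /rdvd_iso/pM.
  by case=> /rdvd_iso; [left|right].
Qed.

End FactorialIso.

Lemma factorial_iso (R S : idomainType) (f : {rmorphism R -> S})
    (g : {rmorphism S -> R}) : cancel f g -> cancel g f ->
  factorial_ring S -> factorial_ring R.
Proof.
move=> fK gK facS a a0; have [|n] := facS (f a).
  by rewrite -(rmorph0 f) (can_eq fK).
move=> fa; exists n; rewrite -[a]fK; elim: fa => [u v uv|m p b pp _ IH].
  by apply: (@Factored_unit _ _ (g v)); rewrite -rmorphM uv rmorph1.
by rewrite rmorphM; apply: Factored_mul => //; exact/(rprime_iso gK fK).
Qed.

(** * Polynomials in [n.+1] variables as univariate polynomials *)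

Local Notation widen := (widen_ord (leqnSn _)).

Lemma mpoly_rmorph_eq n (R S : comNzRingType) (f g : {rmorphism {mpoly R[n]} -> S}) :
  (forall c, f c%:MP = g c%:MP) -> (forall i, f 'X_i = g 'X_i) -> f =1 g.
Proof.
move=> fgC fgX p; rewrite [p]mpolyE !rmorph_sum; apply: eq_bigr => m _.
rewrite -mul_mpolyC !rmorphM fgC mpolyXE_id !rmorph_prod; congr (_ * _).
by apply: eq_bigr => i _; rewrite !rmorphXn fgX.
Qed.

Section MPolyUniIso.
Variables (n : nat) (R : comNzRingType).

Lemma muniX_widen (i : 'I_n) : muni ('X_(widen i) : {mpoly R[n.+1]}) = ('X_i)%:P.
Proof.
rewrite muniE msuppX big_seq1 mcoeffX eqxx scale1r mnmE.
rewrite -val_eqE /= ltn_eqF // expr0 alg_polyC; congr ('X_[_])%:P.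
by apply/mnmP => j; rewrite !mnmE -val_eqE.
Qed.

Lemma muniX_max : muni ('X_ord_max : {mpoly R[n.+1]}) = 'X.
Proof.
rewrite muniE msuppX big_seq1 mcoeffX eqxx scale1r mnmE eqxx expr1.
rewrite (_ : [multinom _ | i < n] = 0%MM) ?mpolyX0 ?scale1r //.
by apply/mnmP => j; rewrite !mnmE -val_eqE /= eq_sym ltn_eqF.
Qed.

Definition muni_inv : {poly {mpoly R[n]}} -> {mpoly R[n.+1]} :=
  horner_eval 'X_ord_max \o map_poly (@mwiden n R).

HB.instance Definition _ := GRing.RMorphism.on muni_inv.

Lemma muni_invC c : muni_inv c%:P = mwiden c.
Proof. by rewrite /muni_inv /= map_polyC /horner_eval hornerC. Qed.

Lemma muni_invX : muni_inv 'X = 'X_ord_max.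
Proof. by rewrite /muni_inv /= map_polyX /horner_eval hornerX. Qed.

Lemma ord_widenP (i : 'I_n.+1) : i = ord_max \/ exists j : 'I_n, i = widen j.
Proof.
have [lt|] := ltnP i n; last first.
  by move=> le; left; apply/val_inj/eqP; rewrite /= eqn_leq le -ltnS ltn_ord.
by right; exists (Ordinal lt); exact: val_inj.
Qed.

Lemma muniK : cancel (@muni n R) muni_inv.
Proof.
apply: (@mpoly_rmorph_eq _ _ _ (muni_inv \o @muni n R) idfun) => [c|i] /=.
  by rewrite muniC muni_invC mwidenC.
have [->|[j ->]] := ord_widenP i; first by rewrite muniX_max muni_invX.
by rewrite muniX_widen muni_invC /mwiden mmapX mmap1U.
Qed.

Lemma muni_widen c : muni (mwiden c) = c%:P :> {poly {mpoly R[n]}}.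
Proof.
apply: (@mpoly_rmorph_eq _ _ _ (@muni n R \o @mwiden n R) polyC) => [a|i] /=.
  by rewrite mwidenC muniC.
by rewrite /mwiden mmapX mmap1U muniX_widen.
Qed.

Lemma muni_invK : cancel muni_inv (@muni n R).
Proof.
elim/poly_ind => [|p c IH]; first by rewrite !rmorph0.
by rewrite !(rmorphD, rmorphM) /= muni_invX muniX_max IH muni_invC muni_widen.
Qed.

Lemma meval_muni (v : 'I_n.+1 -> R) p :
  p.@[v] = (map_poly (meval (fun i => v (widen i))) (muni p)).[v ord_max].
Proof.
set w := fun i => _.
pose g : {rmorphism {mpoly R[n.+1]} -> R} :=
  horner_eval (v ord_max) \o (map_poly (meval w) \o @muni n R).
apply: (@mpoly_rmorph_eq _ _ _ (meval v) g) => [c|i].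
  by rewrite /= muniC map_polyC /= !mevalC /horner_eval hornerC.
rewrite /= mevalXU; have [->|[j ->]] := ord_widenP i.
  by rewrite muniX_max map_polyX /horner_eval hornerX.
by rewrite muniX_widen map_polyC /= mevalXU /horner_eval hornerC.
Qed.

End MPolyUniIso.

Lemma factorial_mpoly (k : fieldType) n : factorial_ring {mpoly k[n]}.
Proof.
elim: n => [a|n IH].
  rewrite (nvar0_mpolyC a) mpolyC_eq0 => a0; exists 0%N.
  by apply: (@Factored_unit _ _ (a@_0%MM)^-1%:MP); rewrite -mpolyCM mulfV.
exact: (factorial_iso (@muniK n k) (@muni_invK n k) (factorial_poly IH)).
Qed.

(** * A Nullstellensatz for hypersurfaces *)

Section Nullstellensatz.
Variable k : closedFieldType.

Lemma mpoly_nonroot n (p : {mpoly k[n]}) : p != 0 -> exists v, p.@[v] != 0.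
Proof.
elim: n p => [|n IH] p p0.
  exists (fun=> 0); move: p0; rewrite (nvar0_mpolyC p).
  by rewrite mpolyC_eq0 mevalC.
have : lead_coef (muni p) != 0.
  by rewrite lead_coef_eq0 -(rmorph0 (@muni n k)) (can_eq (@muniK n k)).
move=> /IH[w w0]; have : map_poly (meval w) (muni p) != 0.
  apply: contra_neq w0 => /(congr1 (fun q : {poly k} => q`_(size (muni p)).-1)).
  by rewrite coef_map coef0.
move=> /closed_nonrootP[x /negbTE xP].
pose v := fun i : 'I_n.+1 => if unlift ord_max i is Some j then w j else x.
exists v; rewrite meval_muni /v unlift_none.
rewrite (_ : (fun i => _) = w); last first.
  apply/funext => i; rewrite (_ : widen i = lift ord_max i) ?liftK //.
  by apply: val_inj; rewrite /= /bump leqNgt ltn_ord.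
by apply/negPf.
Qed.

(** Induction on the number of variables. If [p] does not involve the last one, some coefficient of
    [F] in that variable is not divisible by [p], and the induction hypothesis applies to it.
    Otherwise a Bezout identity controls the common roots. *)
Lemma rprime_nullstellensatz n (p F : {mpoly k[n]}) :
  rprime p -> ~ rdvd p F -> exists v, p.@[v] = 0 /\ F.@[v] != 0.
Proof.
elim: n p F => [|n IH] p F pp pF.
  case: pp => p0 p1 _; case: p1; exists (p@_0%MM)^-1%:MP.
  rewrite {2}(nvar0_mpolyC p) -mpolyCM mulVf //.
  by move: p0; rewrite {1}(nvar0_mpolyC p) mpolyC_eq0.
have evalE w x : exists v, forall q : {mpoly k[n.+1]},
    q.@[v] = (map_poly (meval w) (muni q)).[x].
  exists (fun i : 'I_n.+1 => if unlift ord_max i is Some j then w j else x) => q.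
  rewrite meval_muni unlift_none; congr (map_poly (meval _) _).[_].
  apply/funext => i; rewrite (_ : widen i = lift ord_max i) ?liftK //.
  by apply: val_inj; rewrite /= /bump leqNgt ltn_ord.
suff [w [x [px Fx]]] : exists (w : 'I_n -> k) (x : k),
    (map_poly (meval w) (muni p)).[x] = 0 /\
    (map_poly (meval w) (muni F)).[x] != 0.
  by have [v vE] := evalE w x; exists v; rewrite !vE.
have {pp}pp : rprime (muni p) by exact/(rprime_iso (@muniK n k) (@muni_invK n k)).
have {pF}pF : ~ rdvd (muni p) (muni F).
  by move=> /(rdvd_iso (@muniK n k)).
move: (muni p) (muni F) pp pF => {evalE} {}p {}F pp pF.
have p0 := rprime_neq0 pp.
have [sp|sp] := leqP (size p) 1.
  have pE := size1_polyC sp; set c := p`_0 in pE.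
  have pc : rprime c.
    split; first by move: p0; rewrite pE polyC_eq0.
    - move=> [u uE]; case: pp => _ + _; apply; exists u%:P.
      by rewrite pE -polyCM -uE.
    - move=> a b [u uE]; have : rdvd p (a%:P * b%:P).
        by exists u%:P; rewrite pE -!polyCM uE.
      move=> /(rprime_mul pp); rewrite pE !rdvd_polyC.
      by case=> /(_ 0%N); rewrite coefC; [left|right].
  move: pF; rewrite pE rdvd_polyC => /existsNP[i ci].
  have [w [cw Fw]] := IH _ _ pc ci.
  have : map_poly (meval w) F != 0.
    apply: contra_neq Fw => /(congr1 (fun q : {poly k} => q`_i)).
    by rewrite coef_map coef0.
  move=> /closed_nonrootP[x xF]; exists w, x; split=> //.
  by rewrite map_polyC hornerC.
(* Bezout over the fraction field of the coefficients: away from finitely many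
   hypersurfaces in the other variables, p and F have no common root. *)
have cop : coprimep p F.
  have [[c q] /= c0 e] := Pdiv.Idomain.dvdpP _ _ (dvdp_gcdl p F).
  have [[c' q'] /= c'0 e'] := Pdiv.Idomain.dvdpP _ _ (dvdp_gcdr p F).
  set g := gcdp p F in e e' *.
  (* By primality either [p] divides [q], and then the gcd [g] is constant, or it divides [g], hence
     [c'%:P * F], hence a nonzero constant or [F], which are both excluded. *)
  have : rdvd p (q * g) by rewrite -e -mul_polyC; exists c%:P.
  move=> /(rprime_mul pp)[] [h hE].
    move: e; rewrite hE -mul_polyC mulrAC => /(mulIf p0) e.
    have : size (h * g) = 1%N by rewrite -e size_polyC c0.
    by move=> /eqP; rewrite size_mul_eq1 => /andP[].
  have : rdvd p (c'%:P * F).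
    by rewrite mul_polyC e' hE; exists (q' * h); rewrite mulrA.
  move=> /(rprime_mul pp)[] // [a aE]; move: (size_polyC c'); rewrite aE c'0.
  have a0 : a != 0 by apply: contraNneq c'0 => a0; rewrite -polyC_eq0 aE a0 mul0r.
  move: (a0); rewrite -size_poly_gt0 size_mul //.
  by case: (size a) (size p) sp => [|m] [|[|l]] // _ _; rewrite addSn !addnS.
have [[a b] /= /eqpP[[c1 c2] /= /andP[c10 c20] e]] := Bezout_coprimepP _ _ cop.
have lp0 : lead_coef p != 0 by rewrite lead_coef_eq0.
(* At [w] the leading coefficient of [p] survives, so the specialized [p] keeps its degree and has a
   root; the Bezout constant [c2] survives too, so [F] cannot vanish at that root. *)
have [w] := mpoly_nonroot (mulf_neq0 lp0 c20).
rewrite mevalM mulf_eq0 negb_or => /andP[lw c2w].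
have spw : size (map_poly (meval w) p) = size p by rewrite size_map_poly_id0.
have /closed_rootP[x /rootP px] : size (map_poly (meval w) p) != 1%N.
  by rewrite spw neq_ltn sp orbT.
exists w, x; split=> //; apply: contra_neq c2w => Fx.
move/(congr1 (fun q : {poly {mpoly k[n]}} => (map_poly (meval w) q).[x])): e.
rewrite -!mul_polyC !rmorphM !rmorphD !rmorphM /= !map_polyC.
by rewrite !(hornerM, hornerD, hornerC) /= px Fx !mulr0 addr0 mulr0 meval1 mulr1 => <-.
Qed.

End Nullstellensatz.

(** * Homogeneous divisors and multiplicities *)

Section HomogeneousDivisors.
Variables (k : fieldType) (n : nat).
Implicit Types p q : {mpoly k[n]}.

(* p(t x_1, ..., t x_n), as a polynomial in t: its coefficients are the
   homogeneous components of p. *)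
Definition mdilate : {mpoly k[n]} -> {poly {mpoly k[n]}} :=
  mmap (polyC \o @mpolyC n k) (fun i => ('X_i)%:P * 'X).

HB.instance Definition _ := GRing.RMorphism.on mdilate.

Lemma coef_mdilate p i : (mdilate p)`_i = pihomog mdeg i p.
Proof.
rewrite /mdilate /mmap coef_sum pihomogE [RHS]big_mkcond /=.
apply: eq_bigr => m _; rewrite coefCM /mmap1.
under eq_bigr do rewrite exprMn -rmorphXn.
rewrite big_split /= -rmorph_prod prodrXr -mdegE -mpolyXE_id coefCM coefXn.
by rewrite eq_sym mul_mpolyC; case: ifP; rewrite ?mulr1 ?mulr0 ?scaler0.
Qed.

Lemma mdilate_homog p d : p \is d.-homog -> mdilate p = p *: 'X^d.
Proof.
move=> hp; apply/polyP => i; rewrite coef_mdilate coefZ coefXn eq_sym.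
have [<-|ne] := eqVneq d i; first by rewrite pihomog_dE // mulr1.
by rewrite (pihomog_ne0 _ hp) // mulr0.
Qed.

(** Once the powers of ['X] are stripped off both factors, the remaining product has nonzero
    constant term, hence is the constant [c], and so both of its factors are constants. *)
Lemma monomial_factorl (R : idomainType) (P Q : {poly R}) c d : c != 0 ->
  P * Q = c *: 'X^d -> exists i a, P = a *: 'X^i.
Proof.
move=> c0 e; have PQ0 : P * Q != 0.
  by rewrite e -mul_polyC mulf_neq0 ?polyC_eq0 ?expf_neq0 ?polyX_eq0.
have [P0 Q0] : P != 0 /\ Q != 0 by apply/andP; rewrite -negb_or -mulf_eq0.
have [i [P' + PE]] := multiplicity_XsubC P 0; rewrite P0 /= => rP'.
have [j [Q' + QE]] := multiplicity_XsubC Q 0; rewrite Q0 /= => rQ'.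
rewrite subr0 in PE QE.
have e' : (P' * Q') * 'X^(i + j) = c *: 'X^d by rewrite -e PE QE exprD; ring.
have PQ'0 : (P' * Q')`_0 != 0.
  by rewrite coef0M -!horner_coef0 mulf_neq0.
have ij : (i + j)%N = d.
  have := congr1 (fun q : {poly R} => q`_(i + j)) e'.
  rewrite coefMXn ltnn subnn coefZ coefXn; case: eqP => // _.
  by rewrite mulr0 => PQ00; rewrite PQ00 eqxx in PQ'0.
move: e'; rewrite ij -mul_polyC => /(mulIf (_ : 'X^d != 0 :> {poly R})).
rewrite expf_neq0 ?polyX_eq0 // => /(_ isT) e'.
have : size (P' * Q') = 1%N by rewrite e' size_polyC c0.
move=> /eqP; rewrite size_mul_eq1 => /andP[/size_poly1P[a a0 P'E] _].
by exists i, a; rewrite PE P'E mul_polyC.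
Qed.

(** The dilation of [p * q] is a monomial in t, so that of [p] is one as well: a single homogeneous
    component of [p] is nonzero. *)
Lemma dhomog_factorl p q d : p * q != 0 -> p * q \is d.-homog ->
  exists e, p \is e.-homog.
Proof.
move=> pq0 /mdilate_homog; rewrite rmorphM => /(monomial_factorl pq0)[i [a pE]].
exists i; rewrite homog_piE; apply/eqP.
rewrite [RHS](pihomog_partitionE (mf := mdeg) (k := maxn (msize p) i.+1)) ?leq_maxl //.
have lt : (i < maxn (msize p) i.+1)%N by rewrite leq_max ltnSn orbT.
rewrite (bigD1 (Ordinal lt)) //= big1 ?addr0 // => j.
rewrite -val_eqE /= -coef_mdilate pE coefZ coefXn => /negbTE->.
by rewrite mulr0.
Qed.

Lemma dhomog_factors p q d : p * q != 0 -> p * q \is d.-homog ->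
  exists i j, [/\ p \is i.-homog, q \is j.-homog & d = (i + j)%N].
Proof.
move=> pq0 hpq; have [i hi] := dhomog_factorl pq0 hpq.
have [j hj] : exists j, q \is j.-homog.
  by apply: (@dhomog_factorl _ p d); rewrite mulrC.
by exists i, j; split=> //; exact: dhomog_uniq pq0 hpq (dhomogM hi hj).
Qed.

End HomogeneousDivisors.

(** * Orders along prime elements *)

Section Multiplicity.
Variable R : idomainType.
Hypothesis facR : factorial_ring R.
Implicit Types p q a b : R.

Lemma rord_exists p a : rprime p -> a != 0 ->
  exists e b, a = p ^+ e * b /\ ~ rdvd p b.
Proof.
move=> pp /facR[n]; elim: n a => [|n IH] a fa.
  exists 0%N, a; split; first by rewrite mul1r.
  by case=> b e; have [] := factored_divp pp fa (etrans e (mulrC _ _)).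
have [[b e]|npa] := pselect (rdvd p a); last by exists 0%N, a; split; rewrite ?mul1r.
have [m [<-] /IH[i [c [bE pc]]]] := factored_divp pp fa (etrans e (mulrC _ _)).
by exists i.+1, c; split=> //; rewrite e bE exprS; ring.
Qed.

Lemma rord_uniq p e e' b b' : rprime p -> ~ rdvd p b -> ~ rdvd p b' ->
  p ^+ e * b = p ^+ e' * b' -> e = e'.
Proof.
move=> pp; wlog le : e e' b b' / (e <= e')%N.
  move=> H pb pb' h; have [le|/ltnW le] := leqP e e'.
    exact: H le pb pb' h.
  exact/esym/(H _ _ _ _ le pb' pb (esym h)).
move=> pb _; rewrite -(subnKC le) exprD -mulrA => /mulfI.
rewrite expf_neq0 ?rprime_neq0 // => /(_ isT).
case: (e' - e)%N => [|m] bE; first by rewrite addn0.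
by case: pb; rewrite bE exprS; exists (p ^+ m * b'); ring.
Qed.

Definition rord p a : nat := xget 0%N [set e | exists b, a = p ^+ e * b /\ ~ rdvd p b].

Lemma rordP p a : rprime p -> a != 0 ->
  exists b, a = p ^+ (rord p a) * b /\ ~ rdvd p b.
Proof.
move=> pp a0; rewrite /rord; case: xgetP => [e _ //|].
by have [e [b eb]] := rord_exists pp a0 => /(_ e); case; exists b.
Qed.

Lemma rord_eq p e b : rprime p -> ~ rdvd p b -> rord p (p ^+ e * b) = e.
Proof.
move=> pp pb; have b0 : b != 0 by apply: contra_not_neq pb => ->; exact: rdvd0.
have [|c [cE pc]] := rordP pp (a := p ^+ e * b).
  by rewrite mulf_neq0 // expf_neq0 // rprime_neq0.
exact/esym/(rord_uniq pp pb pc cE).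
Qed.

Lemma rordM p a b : rprime p -> a != 0 -> b != 0 ->
  rord p (a * b) = (rord p a + rord p b)%N.
Proof.
move=> pp a0 b0; have [c [aE pc]] := rordP pp a0; have [d [bE pd]] := rordP pp b0.
rewrite {1}aE {1}bE mulrACA -exprD rord_eq // => /(rprime_mul pp)[] //.
Qed.

Lemma rord_ndvd p a : rprime p -> ~ rdvd p a -> rord p a = 0%N.
Proof. by move=> pp pa; rewrite -[a]mul1r -(expr0 p) rord_eq. Qed.

Lemma rdvd_rord p a : rprime p -> a != 0 -> (0 < rord p a)%N -> rdvd p a.
Proof.
move=> pp a0; have [b [aE pb]] := rordP pp a0.
case: (rord p a) aE => // e -> _; rewrite exprS -mulrA.
by apply: rdvd_mulr; exact: rdvd_refl.
Qed.

Lemma rord_exp p e : rprime p -> rord p (p ^+ e) = e.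
Proof. by move=> pp; rewrite -[p ^+ e]mulr1 rord_eq //; case: pp. Qed.

Lemma rord_prime p : rprime p -> rord p p = 1%N.
Proof. by move=> pp; rewrite -{2}[p]expr1 rord_exp. Qed.

Lemma rdvd_prime_sym p q : rprime p -> rprime q -> rdvd p q -> rdvd q p.
Proof.
move=> pp pq /(rprime_assoc pp pq)[u [v [uv ->]]].
by exists v; rewrite mulrA [v * u]mulrC uv mul1r.
Qed.

Lemma rord_assoc p q a : rprime p -> rprime q -> rdvd p q -> a != 0 ->
  rord p a = rord q a.
Proof.
move=> pp pq pdq a0; have [b [aE qb]] := rordP pq a0.
have [u [v [uv qE]]] := rprime_assoc pp pq pdq.
rewrite {1}aE {1}qE exprMn mulrAC mulrC rord_eq // => /(rprime_mul pp)[].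
  elim: (rord q a) => [|e IH]; first by rewrite expr0; case: pp.
  by rewrite exprS => /(rprime_mul pp)[|//]; exact: rprime_ndvd_unit uv.
by move/(rdvd_trans (rdvd_prime_sym pp pq pdq)).
Qed.

Lemma rord_ndvd_exp p q e : rprime p -> ~ rdvd p q -> rord p (q ^+ e) = 0%N.
Proof.
move=> pp pq; apply: rord_ndvd => //; elim: e => [|e IH].
  by rewrite expr0; case: pp.
by rewrite exprS => /(rprime_mul pp)[].
Qed.

End Multiplicity.

(** * Multiplicative cocycles on open subsets of affine space *)

Section Cocycle.
Variables (k : closedFieldType) (n : nat).
Local Notation A := {mpoly k[n]}.
Implicit Types (p q f F P Q X Y : A) (v w : 'rV[k]_n) (g : 'rV[k]_n -> k).

Definition peval p w : k := p.@[fun i => w 0 i].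

Lemma pevalM p q w : peval (p * q) w = peval p w * peval q w.
Proof. exact: mevalM. Qed.

Lemma pevalB p q w : peval (p - q) w = peval p w - peval q w.
Proof. exact: mevalB. Qed.

Lemma peval0 w : peval 0 w = 0.
Proof. exact: meval0. Qed.

Lemma peval1 w : peval 1 w = 1.
Proof. exact: meval1. Qed.

Lemma peval_neq0 p w : peval p w != 0 -> p != 0.
Proof. by apply: contra_neq => ->; rewrite peval0. Qed.

Lemma peval_nonroot p : p != 0 -> exists w, peval p w != 0.
Proof.
move=> /mpoly_nonroot[v pv]; exists (\row_i v i).
by rewrite /peval (meval_eq _ (v2 := v)) // => i; rewrite mxE.
Qed.

Lemma peval_eq f p q : f != 0 ->
  (forall w, peval f w != 0 -> peval p w = peval q w) -> p = q.
Proof.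
move=> f0 fpq; apply/eqP; rewrite -subr_eq0; apply: contraPT isT => pq0.
have [w] := peval_nonroot (mulf_neq0 f0 pq0); rewrite pevalM pevalB.
have [->|fw] := eqVneq (peval f w) 0; first by rewrite mul0r eqxx.
by rewrite fpq // subrr mulr0 eqxx.
Qed.

Lemma rdvd_peval p q w : rdvd p q -> peval q w != 0 -> peval p w != 0.
Proof. by move=> [c ->]; rewrite pevalM mulf_eq0 negb_or => /andP[]. Qed.

Lemma peval_nullstellensatz p F : rprime p -> ~ rdvd p F ->
  exists w, peval p w = 0 /\ peval F w != 0.
Proof.
move=> pp /(rprime_nullstellensatz pp)[v vP]; exists (\row_i v i).
rewrite /peval !(meval_eq _ (v2 := v)) // => i; by rewrite mxE.
Qed.

Lemma unit_peval p q w : p * q = 1 -> peval p w != 0.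
Proof.
move=> pq; have : peval (p * q) w != 0 by rewrite pq peval1 oner_eq0.
by rewrite pevalM mulf_eq0 negb_or => /andP[].
Qed.

(** [g] is an invertible regular function on the principal open set [f != 0]; its values elsewhere
    are unconstrained. *)
Definition ratunit f P Q g :=
  forall w, peval f w != 0 -> [/\ peval P w != 0, peval Q w != 0 &
    g w = peval P w / peval Q w].

Lemma ratunitV f P Q g : ratunit f P Q g -> ratunit f Q P (fun w => (g w)^-1).
Proof. by move=> h w /h[Pw Qw gw]; split=> //=; rewrite gw invf_div. Qed.

Lemma ratunit_cross f P Q g f' P' Q' : ratunit f P Q g -> ratunit f' P' Q' g ->
  f * f' != 0 -> P * Q' = P' * Q.
Proof.
move=> h h' ff'; apply: (peval_eq ff') => w.
rewrite pevalM mulf_eq0 negb_or => /andP[/h[_ Q0 gw] /h'[_ Q'0]].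
by rewrite gw => /eqP; rewrite eqr_div // -!pevalM => /eqP.
Qed.

Let fac := @factorial_mpoly k n.

(** A unit has no zero along a hypersurface that meets its domain. Take [v] on [p = 0] outside
    [F = 0] and outside the zeros of the [p]-free part [Q1] of [Q]. Comparing with a fraction
    [P' / Q'] near [v] and cancelling powers of [p], an excess of [p] in [P] would make [P' * Q1]
    vanish at [v]. *)
Lemma ratunit_rord_le p F P Q f g : rprime p -> ~ rdvd p F -> P != 0 -> Q != 0 ->
  f != 0 -> ratunit f P Q g ->
  (forall v, peval F v != 0 -> exists f' P' Q', peval f' v != 0 /\ ratunit f' P' Q' g) ->
  (rord p P <= rord p Q)%N.
Proof.
move=> pp pF P0 Q0 f0 gPQ gF; rewrite leqNgt; apply/negP => lt.
have [P1 [PE _]] := rordP fac pp P0; have [Q1 [QE pQ1]] := rordP fac pp Q0.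
have [|v [pv]] := @peval_nullstellensatz p (F * Q1) pp.
  by move=> /(rprime_mul pp)[].
rewrite pevalM mulf_eq0 negb_or => /andP[Fv Q1v].
have [f' [P' [Q' [f'v g']]]] := gF v Fv.
have := ratunit_cross gPQ g' (mulf_neq0 f0 (peval_neq0 f'v)).
rewrite {1}PE {1}QE -(subnKC lt) addSnnS exprD mulrCA -!mulrA.
move=> /mulfI; rewrite expf_neq0 ?rprime_neq0 // => /(_ isT).
move/(congr1 (peval^~ v)); rewrite exprS -!mulrA !pevalM pv !mul0r => /esym/eqP.
by have [P'v _ _] := g' v f'v; rewrite mulf_eq0 (negbTE P'v) (negbTE Q1v).
Qed.

Lemma ratunit_rord p F P Q f g : rprime p -> ~ rdvd p F -> P != 0 -> Q != 0 ->
  f != 0 -> ratunit f P Q g ->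
  (forall v, peval F v != 0 -> exists f' P' Q', peval f' v != 0 /\ ratunit f' P' Q' g) ->
  rord p P = rord p Q.
Proof.
move=> pp pF P0 Q0 f0 gPQ gF; apply/eqP; rewrite eqn_leq.
rewrite (ratunit_rord_le pp pF P0 Q0 f0 gPQ gF) /=.
apply: (ratunit_rord_le pp pF Q0 P0 f0 (ratunitV gPQ)) => v /gF.
move=> [f' [P' [Q' [f'v g']]]]; exists f', Q', P'; split=> //; exact: ratunitV.
Qed.

(** Primes not dividing [F] occur equally often in [P] and [Q] and are collected in [h]. Those
    dividing [F] may remain in [X] and [Y], since they have no zero where [F] has none. *)
Lemma ratunit_reduce F P Q : P != 0 -> Q != 0 ->
  (forall p, rprime p -> ~ rdvd p F -> rord p P = rord p Q) ->
  exists h X Y, [/\ P = h * X, Q = h * Y &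
    forall w, peval F w != 0 -> peval X w != 0 /\ peval Y w != 0].
Proof.
move=> /fac[m fP]; elim: fP Q => [u v uv|{}m p P' pp fP' IH] Q Q0 ordPQ.
  exists 1, u, Q; rewrite !mul1r; split=> // w Fw.
  split; first exact: unit_peval uv.
  have {ordPQ} : forall p, rprime p -> rdvd p Q -> rdvd p F.
    move=> p pp pQ; apply: contrapT => pF; have := ordPQ p pp pF.
    rewrite rord_ndvd //; last exact: rprime_ndvd_unit uv.
    by case: pQ => c QE; rewrite QE rordM ?(rord_prime fac pp) ?addn1 //;
      [apply: contraNneq Q0 => c0; rewrite QE c0 mul0r | exact: rprime_neq0].
  have [l fQ] := fac Q0; elim: fQ => [a b ab _|{}l p c pp _ IH H].
    exact: unit_peval ab.
  rewrite pevalM mulf_neq0 //.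
    by apply: (rdvd_peval (H p pp _) Fw); exact: (rdvd_mulr _ (rdvd_refl _)).
  by apply: IH => q pq qc; apply: H => //; exact: rdvd_mull.
have P'0 := factored_neq0 fP'; have p0 := rprime_neq0 pp.
have [pF|pF] := pselect (rdvd p F).
  have [|h [X [Y [P'E QE hXY]]]] := IH Q Q0.
    move=> q pq qF; rewrite -ordPQ // rordM // [rord q p]rord_ndvd //.
    by move=> qp; apply: qF; exact: rdvd_trans pF.
  exists h, (p * X), Y; split=> // [|w Fw]; first by rewrite P'E mulrCA.
  by have [Xw Yw] := hXY w Fw; rewrite pevalM mulf_neq0 // (rdvd_peval pF).
have [|Q' QE] := rdvd_rord fac pp Q0.
  by rewrite -ordPQ // rordM // rord_prime.
have Q'0 : Q' != 0 by apply: contraNneq Q0 => c0; rewrite QE c0 mul0r.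
have [|h [X [Y [P'E Q'E hXY]]]] := IH Q' Q'0.
  move=> q pq qF; apply: (@addnI (rord q p)).
  by rewrite -!rordM // ordPQ // QE mulrC.
by exists (p * h), X, Y; split=> //; rewrite ?QE ?P'E ?Q'E; ring.
Qed.

Variables (I : Type) (W : I -> set 'rV[k]_n) (G : I -> I -> 'rV[k]_n -> k).
Hypothesis W_open : forall i v, W i v -> exists f d,
  [/\ f \is d.-homog, peval f v != 0 & forall w, peval f w != 0 -> W i w].
Hypothesis G_regular : forall i j v, W i v -> W j v -> exists f P Q d,
  [/\ peval f v != 0, P \is d.-homog, Q \is d.-homog & ratunit f P Q (G i j)].
Hypothesis G_cocycle : forall i j l v, W i v -> W j v -> W l v ->
  G i j v * G j l v = G i l v.

(** The numbers [a] and [b] are the degrees of numerator and denominator of the global fraction h.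
    The common weight of the [T i] is b - a, expressed without subtraction by [x + a = y + b]. *)
Lemma cocycle_trivial : exists (a b : nat) (T : I -> 'rV[k]_n -> k),
  (forall i v, W i v -> exists f X Y d x y,
     [/\ f \is d.-homog, peval f v != 0, forall w, peval f w != 0 -> W i w &
         [/\ X \is x.-homog, Y \is y.-homog, (x + a = y + b)%N &
             ratunit f X Y (T i)]]) /\
  (forall i j v, W i v -> W j v -> T i v = G i j v * T j v).
Proof.
have [[i0 [v0 W0]]|W0] := pselect (exists i v, W i v); last first.
  exists 0%N, 0%N, (fun _ _ => 0); split=> [i v Wv|i j v Wv];
  by case: W0; exists i, v.
have /choice[f fP] : forall z : I * 'rV[k]_n, exists f, W z.1 z.2 -> exists d,
  [/\ f \is d.-homog, peval f z.2 != 0 & forall w, peval f w != 0 -> W z.1 w].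
  move=> [i v]; have [Wv|Wv] := pselect (W i v); last by exists 0.
  by have [f [d h]] := W_open Wv; exists f => _; exists d.
have f_neq0 i v : W i v -> f (i, v) != 0.
  by move=> /(fP (i, v))[d [_ /peval_neq0]].
(* The rational function G i i0, for each i with W i nonempty. *)
have /choice[r rP] : forall i, exists r : A * A, (exists v, W i v) ->
    exists f d, [/\ f != 0, r.1 \is d.-homog, r.2 \is d.-homog &
      ratunit f r.1 r.2 (G i i0)].
  move=> i; have [[v Wv]|Wi] := pselect (exists v, W i v); last by exists (0, 0).
  (* Affine space is irreducible: the two principal open sets meet, so [G i i0] is defined
     somewhere. *)
  have [w] := peval_nonroot (mulf_neq0 (f_neq0 _ _ Wv) (f_neq0 _ _ W0)).
  rewrite pevalM mulf_eq0 negb_or => /andP[].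
  have [_ [_ _ h]] := fP (i, v) Wv; have [_ [_ _ h0]] := fP (i0, v0) W0.
  move=> /h /= Ww /h0 /= W0w.
  have [f' [P [Q [d [f'0 hP hQ hG]]]]] := G_regular Ww W0w.
  by exists (P, Q) => _; exists f', d; split=> //; exact: peval_neq0 f'0.
have r_neq0 i v : W i v -> (r i).1 != 0 /\ (r i).2 != 0.
  move=> Wv; have [|f' [d [/peval_nonroot[w f'w] _ _ /(_ w f'w)[]]]] := rP i.
    by exists v.
  by move=> /peval_neq0 + /peval_neq0.
pose A_ i := (r i).1; pose B_ i := (r i).2.
have A0 i v : W i v -> A_ i != 0 by move=> /r_neq0[].
have B0 i v : W i v -> B_ i != 0 by move=> /r_neq0[].
(* The cocycle relation on the triple overlap with [W i0] reads [G i j] = r_i / r_j. *)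
have rG i j v v' : W i v -> W j v' ->
    exists2 f', f' != 0 & ratunit f' (A_ i * B_ j) (B_ i * A_ j) (G i j).
  move=> Wi Wj; have [|fi [_ [fi0 _ _ hi]]] := rP i; first by exists v.
  have [|fj [_ [fj0 _ _ hj]]] := rP j; first by exists v'.
  exists (fi * fj * (f (i, v) * f (j, v') * f (i0, v0))).
    by rewrite !mulf_neq0 // f_neq0.
  move=> w; set C := [/\ _, _ & _]; rewrite !pevalM !mulf_eq0 !negb_or -!andbA {}/C.
  move=> /and5P[/hi[Aiw Biw Gi] /hj[Ajw Bjw Gj]].
  have [_ [_ _ h]] := fP (i, v) Wi; have [_ [_ _ h']] := fP (j, v') Wj.
  have [_ [_ _ h0]] := fP (i0, v0) W0.
  move=> /h /= Wiw /h' /= Wjw /h0 /= W0w; rewrite !pevalM; split; try by rewrite mulf_neq0.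
  have := G_cocycle Wiw Wjw W0w; rewrite Gi Gj => e.
  apply: (mulIf (_ : peval (A_ j) w / peval (B_ j) w != 0)).
    by rewrite mulf_neq0 ?invr_neq0.
  by rewrite e; field; rewrite ?Aiw ?Ajw ?Biw ?Bjw.
(* Equality of the orders of r_i and r_j, without subtraction: their quotient [G i j] is a unit on
   the intersection of the two charts, which [p = 0] meets. *)
have compat p i v j v' : rprime p -> W i v -> W j v' ->
    ~ rdvd p (f (i, v)) -> ~ rdvd p (f (j, v')) ->
    (rord p (A_ i) + rord p (B_ j) = rord p (B_ i) + rord p (A_ j))%N.
  move=> pp Wi Wj pi pj; have [f' f'0 hG] := rG i j v v' Wi Wj.
  rewrite -!rordM ?(A0 _ _ Wi, A0 _ _ Wj, B0 _ _ Wi, B0 _ _ Wj) //.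
  apply: (@ratunit_rord p (f (i, v) * f (j, v')) _ _ f' (G i j)) => //.
  - by move=> /(rprime_mul pp)[].
  - by rewrite mulf_neq0 ?(A0 _ _ Wi, B0 _ _ Wj).
  - by rewrite mulf_neq0 ?(A0 _ _ Wj, B0 _ _ Wi).
  move=> w; rewrite pevalM mulf_eq0 negb_or => /andP[fi fj].
  have [_ [_ _ h]] := fP (i, v) Wi; have [_ [_ _ h']] := fP (j, v') Wj.
  have [f1 [P [Q [_ [f1w _ _ h1]]]]] := G_regular (h _ fi) (h' _ fj).
  by exists f1, P, Q.
(* The order along p prescribed by any chart f z <> 0 that meets p = 0.  It can be
   nonzero only at the finitely many prime factors of f (i0, v0). *)
pose good (a b p : A) := forall i v, W i v -> ~ rdvd p (f (i, v)) ->
  (rord p a + rord p (B_ i) = rord p b + rord p (A_ i))%N.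
have [a [b [da [db [ha hb a0 b0 hgood]]]]] : exists a b da db,
    [/\ a \is da.-homog, b \is db.-homog, a != 0, b != 0 &
        forall p, rprime p -> good a b p].
  have [d0 [hf0 _ _]] := fP (i0, v0) W0; rewrite /= in hf0.
  have f00 := f_neq0 _ _ W0; have [m ff0] := fac f00.
  (* The fraction is corrected one prime at a time, [c] being the part of [f (i0, v0)] already
     treated; when [c] is all of it, every prime is covered. *)
  suff H : forall c, factored m c -> rdvd c (f (i0, v0)) -> exists a b da db,
    [/\ a \is da.-homog, b \is db.-homog, a != 0, b != 0 & forall p, rprime p ->
        rdvd p c \/ ~ rdvd p (f (i0, v0)) -> good a b p].
    have [a [b [da [db [ha hb a0 b0 hgood]]]]] := H _ ff0 (rdvd_refl _).
    by exists a, b, da, db; split=> // p pp; apply: hgood => //; exact: EM.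
  move=> c; elim=> [u v uv _|{ff0}l p c' pp _ IH pc'].
    have [|_ [d [_ h1 h2 _]]] := rP i0; first by exists v0.
    (* The fraction r_i0 itself already has the prescribed order along every prime not dividing
       [f (i0, v0)]. *)
    exists (A_ i0), (B_ i0), d, d; split; rewrite ?(A0 _ _ W0) ?(B0 _ _ W0) //.
    move=> p pp [/(rprime_ndvd_unit pp uv)//|p0] i v' Wi pi.
    by have := compat _ _ _ _ _ pp Wi W0 pi p0; lia.
  have [|a [b [da [db [ha hb a0 b0 hgood]]]]] := IH.
    by apply: rdvd_trans pc'; apply: rdvd_mull; exact: rdvd_refl.
  (* If [p] divides the equation of every chart, [good] is an empty condition at its associates;
     otherwise one chart prescribes the order. *)
  have [[[i v] /= [Wi pi]]|nz] :=
    pselect (exists z, W z.1 z.2 /\ ~ rdvd p (f z)); last first.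
    exists a, b, da, db; split=> // q pq [/(rprime_mul pq)[qp|qc']|q0].
    - move=> i v Wi qi; case: nz; exists (i, v); split=> // pi.
      exact/qi/(rdvd_trans qp).
    - by apply: hgood => //; left.
    - by apply: hgood => //; right.
  have [dp hp] : exists d, p \is d.-homog.
    have [x xE] : rdvd p (f (i0, v0)).
      by apply: rdvd_trans pc'; apply: rdvd_mulr; exact: rdvd_refl.
    by apply: (@dhomog_factorl _ _ p x d0); rewrite mulrC -xE.
  (* The exponents are taken crosswise so that both sides of [good] at [p] get the same total,
     whichever order was larger before. *)
  set ea := (rord p b + rord p (A_ i))%N; set eb := (rord p a + rord p (B_ i))%N.
  have p0 := rprime_neq0 pp.
  exists (a * p ^+ ea), (b * p ^+ eb), (da + dp * ea)%N, (db + dp * eb)%N.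
  split; try exact/dhomogM/dhomogMn; try by rewrite mulf_neq0 // expf_neq0.
  move=> q pq hq j v' Wj qj; rewrite !rordM ?expf_neq0 //.
  have [qp|qp] := pselect (rdvd q p).
    have E x : x != 0 -> rord q x = rord p x := rord_assoc fac pq pp qp.
    rewrite !E ?expf_neq0 ?(A0 _ _ Wj) ?(B0 _ _ Wj) // !rord_exp //.
    have := compat p i v j v' pp Wi Wj pi _.
    have pj : ~ rdvd p (f (j, v')) by move=> pj; exact/qj/(rdvd_trans qp).
    move=> /(_ pj); rewrite /ea /eb; lia.
  rewrite !rord_ndvd_exp // !addn0; apply: hgood Wj qj => //.
  by case: hq => [/(rprime_mul pq)[//|]|]; [left|right].
have red z : W z.1 z.2 -> exists XY : A * A, exists x y,
    [/\ XY.1 \is x.-homog, XY.2 \is y.-homog, (x + da = y + db)%N,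
      A_ z.1 * b * XY.2 = B_ z.1 * a * XY.1 &
      forall w, peval (f z) w != 0 -> peval XY.1 w != 0 /\ peval XY.2 w != 0].
  case: z => i v /= Wi; have Ai := A0 _ _ Wi; have Bi := B0 _ _ Wi.
  have [||p pp pi|h [X [Y [PE QE hXY]]]] :=
    @ratunit_reduce (f (i, v)) (A_ i * b) (B_ i * a).
  - by rewrite mulf_neq0.
  - by rewrite mulf_neq0.
  - by rewrite !rordM // addnC -(hgood p pp i v Wi pi) addnC.
  have [|_ [d [_ hA hB _]]] := rP i; first by exists v.
  have hAb := dhomogM hA hb; have hBa := dhomogM hB ha.
  rewrite -/(A_ i) -/(B_ i) in hAb hBa.
  have [||d1 [x [h1 hX e1]]] := @dhomog_factors _ _ h X (d + db)%N;
    rewrite -?PE ?mulf_neq0 //.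
  have [||d2 [y [h2 hY e2]]] := @dhomog_factors _ _ h Y (d + da)%N;
    rewrite -?QE ?mulf_neq0 //.
  have h0 : h != 0 by apply: contraNneq (mulf_neq0 Ai b0); rewrite PE => ->; rewrite mul0r.
  (* The common factor [h] has a single degree, and [A_ i] and [B_ i] have equal degrees; hence the
     degrees of [X] and [Y] differ by [db - da]. *)
  have e12 := dhomog_uniq h0 h1 h2.
  exists (X, Y), x, y.
  have e3 : (x + da = y + db)%N by clear -e1 e2 e12; lia.
  split; [exact: hX|exact: hY|exact: e3| |exact: hXY].
  rewrite PE QE.
  by rewrite [_.2]/= [_.1]/= mulrAC.
have /choice[XY XYP] : forall z, exists XY : A * A, W z.1 z.2 -> exists x y,
    [/\ XY.1 \is x.-homog, XY.2 \is y.-homog, (x + da = y + db)%N,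
      A_ z.1 * b * XY.2 = B_ z.1 * a * XY.1 &
      forall w, peval (f z) w != 0 -> peval XY.1 w != 0 /\ peval XY.2 w != 0].
  move=> z; have [Wz|Wz] := pselect (W z.1 z.2); last by exists (0, 0).
  by have [XY h] := red z Wz; exists XY => _.
(* The value at [v] uses the fraction chosen for the chart at [v]. All choices agree, being equal to
   [A_ i * b] over [B_ i * a] as rational functions. *)
pose T i v := peval (XY (i, v)).1 v / peval (XY (i, v)).2 v.
exists da, db, T; split=> [i v Wi|i j v Wi Wj].
  have [d [hf fv fW]] := fP (i, v) Wi; have [x [y [hX hY e e1 h]]] := XYP (i, v) Wi.
  exists (f (i, v)), (XY (i, v)).1, (XY (i, v)).2, d, x, y; split=> //; split=> //.
  move=> w fw; have [X0 Y0] := h w fw; split=> //.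
  have Wiw := fW w fw; have [x' [y' [_ _ _ e1' h']]] := XYP (i, w) Wiw.
  have [d' [_ f'w _]] := fP (i, w) Wiw; have [X'0 Y'0] := h' w f'w.
  apply/eqP; rewrite eqr_div // -!pevalM; apply/eqP; congr (peval _ w).
  rewrite /= in e1 e1'; apply: (mulfI (mulf_neq0 (mulf_neq0 (A0 _ _ Wi) b0)
    (mulf_neq0 (B0 _ _ Wi) a0))).
  transitivity ((A_ i * b * (XY (i, v)).2) * (B_ i * a * (XY (i, w)).1)); first by ring.
  by rewrite e1 -e1'; ring.
have [d [_ fi _]] := fP (i, v) Wi; have [x [y [_ _ _ ei hi]]] := XYP (i, v) Wi.
have [d' [_ fj _]] := fP (j, v) Wj; have [x' [y' [_ _ _ ej hj]]] := XYP (j, v) Wj.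
have [Xi Yi] := hi v fi; have [Xj Yj] := hj v fj.
have [f' [P [Q [_ [f'v _ _ hG]]]]] := G_regular Wi Wj.
have [P0 Q0 ->] := hG v f'v; rewrite /T mulf_div; apply/eqP.
rewrite eqr_div ?mulf_neq0 // -!pevalM; apply/eqP; congr (peval _ v).
have [f2 f20 hG2] := rG i j v v Wi Wj.
have e := ratunit_cross hG hG2 (mulf_neq0 (peval_neq0 f'v) f20).
rewrite /= in ei ej.
have nz : A_ i * b * (B_ j * a) * (B_ i * A_ j) != 0.
  by rewrite !mulf_neq0 ?(A0 _ _ Wi, A0 _ _ Wj, B0 _ _ Wi, B0 _ _ Wj).
apply: (mulfI nz).
transitivity ((A_ i * B_ j * Q) * (A_ j * b * (XY (j, v)).2) *
  (B_ i * a * (XY (i, v)).1)); first by ring.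
by rewrite -e ej -ei; ring.
Qed.

End Cocycle.

(** * Invertible sheaves and cocycles *)

Local Open Scope classical_set_scope.

Section RegfunValues.
Variables (k : fieldType) (X : fspace k).
Implicit Types U V : opens X.

(** Extension by 0 outside [U] allows functions on different open sets to be compared at points of
    [X] rather than of subtypes. *)
Definition rfval U (f : regfun U) (p : X) : k :=
  if pselect (opens_set U p) is left h then f (exist _ p (mem_set h)) else 0.

Lemma rfvalE U (f : regfun U) (y : U) : f y = rfval f (val y).
Proof.
rewrite /rfval; case: pselect => [h|]; last by case; exact: set_valP.
by congr (regfun_val f _); exact: val_inj.
Qed.

Lemma regfun_eq U (f g : regfun U) :
  (forall p, opens_set U p -> rfval f p = rfval g p) -> f = g.
Proof.
move=> fg; apply/val_inj/funext => y /=; rewrite !rfvalE.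
by apply: fg; exact: set_valP.
Qed.

Lemma rfval_res U V (h : V `<=` U) (f : regfun U) p :
  opens_set V p -> rfval (regfun_res h f) p = rfval f p.
Proof.
move=> Vp; have := rfvalE (regfun_res h f) (exist _ p (mem_set Vp)).
by rewrite [regfun_val _ _]/= rfvalE.
Qed.

Lemma rfvalM U (f g : regfun U) p :
  opens_set U p -> rfval (f * g) p = rfval f p * rfval g p.
Proof. by move=> Up; rewrite /rfval; case: pselect. Qed.

Lemma rfval1 U p : opens_set U p -> rfval (1 : regfun U) p = 1.
Proof. by move=> Up; rewrite /rfval; case: pselect. Qed.

Definition mk_regfun U (f : X -> k) (h : regular_on (fun y : opens_set U => f (val y))) :
  regfun U := RegFun (introT (regularpP _) h).

Lemma rfval_mk U (f : X -> k) (h : regular_on (fun y : opens_set U => f (val y))) p :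
  opens_set U p -> rfval (mk_regfun h) p = f p.
Proof. by move=> Up; rewrite /rfval; case: pselect. Qed.

Definition opensI U V : opens X := Opens (openI (opens_open U) (opens_open V)).

End RegfunValues.

Section ScaleSection.
Variables (k : fieldType) (X : fspace k) (L : omodule X) (V : opens X) (t : L V).

Definition scale_section (a : osheaf X V) : L V := (a : regfun V) *: t.

Lemma scale_section_is_linear : linear scale_section.
Proof.
by move=> a u v; rewrite /scale_section scalerDl -scalerA.
Qed.

HB.instance Definition _ := GRing.isLinear.Build (regfun V) (osheaf X V) (L V) _
  scale_section scale_section_is_linear.

End ScaleSection.

Section Trivialization.
Variables (k : fieldType) (X : fspace k) (L : invertible X).

(** Regularity of the inverses is demanded separately, because the axioms of an [fspace] do not make
    a nowhere zero regular function invertible. *)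
Definition coboundary (U : X -> opens X) (g : X -> X -> X -> k) :=
  exists psi : X -> X -> k, forall x,
  [/\ regular_on (fun p : opens_set (U x) => psi x (val p)),
      regular_on (fun p : opens_set (U x) => (psi x (val p))^-1),
      forall p, opens_set (U x) p -> psi x p != 0 &
      forall y p, opens_set (U x) p -> opens_set (U y) p -> psi x p = g x y p * psi y p].

Hypothesis cocycles_are_coboundaries : forall (U : X -> opens X) (g : X -> X -> X -> k),
  (forall x, opens_set (U x) x) ->
  (forall x y, regular_on (fun p : opens_set (opensI (U x) (U y)) => g x y (val p))) ->
  (forall x p, opens_set (U x) p -> g x x p = 1) ->
  (forall x y z p, opens_set (U x) p -> opens_set (U y) p -> opens_set (U z) p ->
    g x y p * g y z p = g x z p) ->
  coboundary U g.

Lemma invertible_frame : exists (U : X -> opens X) (e : forall x, L (U x)),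
  (forall x, opens_set (U x) x) /\
  forall x (V : opens X) (h : V `<=` U x) (s : L V),
    exists! a : regfun V, s = a *: res h (e x).
Proof.
pose U x := projT1 (cid (invertibleP L x)).
have /all_and2[Ux iso] : forall x, opens_set (U x) x /\
    omodule_iso_over (U x) (osheaf X) L.
  by move=> x; exact: (projT2 (cid (invertibleP L x))).
pose phi x := projT1 (cid (iso x)).
have phiP x := projT2 (cid (iso x)).
exists U, (fun x => phi x (U x) (fun _ => id) (1 : regfun (U x))); split=> // x V h s.
have [bij nat] := phiP x; have [inv invK Kinv] := bij V h.
have E (a : regfun V) : phi x V h a =
    a *: res h (phi x (U x) (fun _ => id) (1 : regfun (U x))).
  rewrite -nat -linearZ; congr (phi x V h _).
  by apply: regfun_eq => p Vp; rewrite rfvalM // rfval_res // rfval1 ?mulr1 //;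
    exact: (h p Vp).
exists (inv s); split; first by rewrite -E Kinv.
by move=> a; rewrite -E => ->; rewrite invK.
Qed.

(** The transition functions are defined by e_x = g_xy e_y. If psi_x = g_xy psi_y, the sections e_x
    / psi_x agree on overlaps and glue to a global generator [s]; multiplication by [s] is the
    isomorphism. *)
Lemma invertible_trivial : omodule_iso (osheaf X) L.
Proof.
have [U [e [Ux frame]]] := invertible_frame.
have frame_inj x (V : opens X) (h : V `<=` U x) (a b : regfun V) :
    a *: res h (e x) = b *: res h (e x) -> a = b.
  move=> ab; have [c [_ uc]] := frame x V h (a *: res h (e x)).
  by rewrite -(uc a) // -(uc b).
have /choice[g gP] : forall xy : X * X, exists g : X -> k,
    exists r : regfun (opensI (U xy.1) (U xy.2)),
    forall (h1 : opensI (U xy.1) (U xy.2) `<=` U xy.1)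
           (h2 : opensI (U xy.1) (U xy.2) `<=` U xy.2),
      res h1 (e xy.1) = r *: res h2 (e xy.2) /\ g = rfval r.
  move=> [x y] /=; set W := opensI _ _.
  have h1 : W `<=` U x by move=> ? [].
  have h2 : W `<=` U y by move=> ? [].
  have [r [rE _]] := frame y W h2 (res h1 (e x)).
  exists (rfval r), r => h1' h2'.
  by rewrite (Prop_irrelevance h1' h1) (Prop_irrelevance h2' h2).
have trans x y (V : opens X) (hx : V `<=` U x) (hy : V `<=` U y) :
    exists r : regfun V, res hx (e x) = r *: res hy (e y) /\
      forall p, opens_set V p -> rfval r p = g (x, y) p.
  have [r rP] := gP (x, y); rewrite /= in r rP.
  have h1 : opensI (U x) (U y) `<=` U x by move=> ? [].
  have h2 : opensI (U x) (U y) `<=` U y by move=> ? [].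
  have hV : V `<=` opensI (U x) (U y) by move=> p Vp; split; [exact: hx|exact: hy].
  have [rE ->] := rP h1 h2; exists (regfun_res hV r); split.
    by rewrite -(res_comp h1 hV) rE resZ (res_comp _ _ hy).
  by move=> p Vp; rewrite rfval_res.
have [||||psi psiP] := @cocycles_are_coboundaries U (fun x y => g (x, y)).
- exact: Ux.
- move=> x y; have [r rP] := gP (x, y); rewrite /= in r rP.
  have h1 : opensI (U x) (U y) `<=` U x by move=> ? [].
  have h2 : opensI (U x) (U y) `<=` U y by move=> ? [].
  have [_ ->] := rP h1 h2.
  rewrite (_ : (fun p => _) = r); first exact: regfunP.
  by apply/funext => p; rewrite rfvalE.
- move=> x p Up; have [r [rE rg]] := trans x x (U x) (fun _ => id) (fun _ => id).
  rewrite -rg // -(rfval1 Up); congr (rfval _ p).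
  by apply: (frame_inj x _ (fun _ => id)); rewrite -rE scale1r.
- move=> x y z p Up Uy Uz; pose V := opensI (opensI (U x) (U y)) (U z).
  have hx : V `<=` U x by move=> ? [[]].
  have hy : V `<=` U y by move=> ? [[]].
  have hz : V `<=` U z by move=> ? [].
  have Vp : opens_set V p by [].
  have [r1 [e1 g1]] := trans x y V hx hy; have [r2 [e2 g2]] := trans y z V hy hz.
  have [r3 [e3 g3]] := trans x z V hx hz.
  rewrite -g1 // -g2 // -g3 // -rfvalM //; congr (rfval _ p).
  by apply: (frame_inj z V hz); rewrite -e3 e1 e2 scalerA.
have reg x : regular_on (fun p : opens_set (U x) => psi x (val p)) by case: (psiP x).
have regV x : regular_on (fun p : opens_set (U x) => (psi x (val p))^-1) by case: (psiP x).
have psi0 x p : opens_set (U x) p -> psi x p != 0 by case: (psiP x) => _ _ + _; exact.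
have psiE x y p : opens_set (U x) p -> opens_set (U y) p ->
  psi x p = g (x, y) p * psi y p by case: (psiP x) => _ _ _ + *; exact.
pose c x := mk_regfun (f := fun p => (psi x p)^-1) (regV x).
pose ci x := mk_regfun (reg x).
have cE x p : opens_set (U x) p -> rfval (c x) p = (psi x p)^-1.
  by move=> Up; rewrite rfval_mk.
have ciE x p : opens_set (U x) p -> rfval (ci x) p = psi x p.
  by move=> Up; rewrite rfval_mk.
have cover (V : opens X) : V `<=` \bigcup_x opensI V (U x) by move=> x Vx; exists x.
have [s [sE _]] : exists! s : L (opensT X), forall x,
    res (fun _ _ => I : opens_set (opensT X) _) s = c x *: e x.
  apply: (res_glue (V := U)); first by move=> x _; exists x.
  move=> x y V hx hy; rewrite !resZ; have [r [-> rg]] := trans x y V hx hy.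
  rewrite scalerA; congr (_ *: _); apply: regfun_eq => p Vp.
  rewrite rfvalM // !rfval_res // !cE; [|exact: hy|exact: hx].
  rewrite rg // (psiE x y); [|exact: hx|exact: hy].
  rewrite invfM mulrAC mulVf ?mul1r //.
  have := psi0 x p (hx p Vp); rewrite (psiE x y); [|exact: hx|exact: hy].
  by rewrite mulf_eq0 negb_or => /andP[].
pose sV V : L V := res (fun _ _ => I : opens_set (opensT X) _) s.
have sVE x (V : opens X) (h : V `<=` U x) : sV V = regfun_res h (c x) *: res h (e x).
  by rewrite -resZ -sE /sV; symmetry; exact: res_comp.
have res_sV (V V' : opens X) (h : V' `<=` V) : res h (sV V) = sV V' by exact: res_comp.
have sV_inj V (a b : regfun V) : a *: sV V = b *: sV V -> a = b.
  move=> ab; apply: regfun_eq => p Vp.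
  have h : opensI V (U p) `<=` V by move=> ? [].
  have h' : opensI V (U p) `<=` U p by move=> ? [].
  have Wp : opens_set (opensI V (U p)) p by [].
  have := congr1 (res h) ab; rewrite !resZ res_sV (sVE _ _ h') !scalerA.
  move=> /(frame_inj _ _ _)/(congr1 (fun r : regfun (opensI V (U p)) => rfval r p)).
  rewrite !rfvalM // !rfval_res // => /mulIf; apply.
  by rewrite cE ?invr_neq0 ?psi0 //.
exists (fun V _ => scale_section (sV V)); split=> [V h|V V' hV hV' h a]; last first.
  by rewrite /scale_section /= resZ res_sV.
(* Coefficients with respect to [s] exist on each [U x] and are unique by [sV_inj], so they glue in
   the structure sheaf. *)
have /choice[inv invE] : forall t : L V, exists a : regfun V, a *: sV V = t.
  move=> t; have hV x : opensI V (U x) `<=` V by move=> ? [].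
  have hU x : opensI V (U x) `<=` U x by move=> ? [].
  have local x : exists a : regfun (opensI V (U x)),
      a *: sV (opensI V (U x)) = res (hV x) t.
    have [b [-> _]] := frame x _ (hU x) (res (hV x) t).
    exists (b * regfun_res (hU x) (ci x)); rewrite (sVE _ _ (hU x)) scalerA.
    congr (_ *: _); apply: regfun_eq => p Vp; have Up := hU x p Vp.
    by rewrite !rfvalM // !rfval_res // ciE // cE // mulfK // psi0.
  pose a x := projT1 (cid (local x)).
  have aE x : a x *: sV _ = res (hV x) t := projT2 (cid (local x)).
  have [|A [AE _]] := @osheaf_glue _ _ _ _ _ hV a (cover V).
    move=> x y W hx hy; apply: sV_inj; have hW : W `<=` V by move=> p /hx[].
    have E z (hz : W `<=` opensI V (U z)) : regfun_res hz (a z) *: sV W = res hW t.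
      by rewrite -(res_sV _ _ hz) -resZ aE (res_comp _ _ hW).
    by rewrite !E.
  exists A; have [|t' [_ u]] := @res_glue _ _ L V _ _ hV (fun x => res (hV x) t) (cover V).
    move=> x y W hx hy; have hW : W `<=` V by move=> p /hx[].
    by rewrite !(res_comp _ _ hW).
  rewrite -(u t) //; symmetry; apply: u => x.
  by rewrite resZ res_sV -aE -AE.
exists inv => [a|t]; last exact: invE.
by apply: sV_inj; rewrite invE.
Qed.

End Trivialization.

Section PicTrivial.
Variables (k : fieldType) (X : fspace k).

Lemma omodule_iso_sym (L M : omodule X) : omodule_iso L M -> omodule_iso M L.
Proof.
move=> [phi [bij nat]].
have inv (V : opens X) (h : V `<=` opensT X) : {f : {linear M V -> L V} |
    cancel f (phi V h) /\ cancel (phi V h) f}.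
  apply: cid; have [f fK Kf] := bij V h.
  have lin : linear f by move=> a u v; apply: (can_inj fK); rewrite Kf linearP !Kf.
  pose f' : {linear M V -> L V} := HB.pack f (GRing.isLinear.Build _ _ _ _ f lin).
  by exists f'.
exists (fun V h => projT1 (inv V h)); split=> [V h|U V hU hV h s].
  by have [fK Kf] := projT2 (inv V h); exists (phi V h).
have [fK Kf] := projT2 (inv V hV); have [fK' Kf'] := projT2 (inv U hU).
by apply: (can_inj Kf); rewrite fK nat fK'.
Qed.

Lemma omodule_iso_trans (L M N : omodule X) :
  omodule_iso L M -> omodule_iso M N -> omodule_iso L N.
Proof.
move=> [phi [bij nat]] [psi [bij' nat']].
exists (fun V h => psi V h \o phi V h : {linear L V -> N V}); split=> [V h|U V hU hV h s].
  exact: bij_comp (bij' V h) (bij V h).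
by rewrite /= nat nat'.
Qed.

Lemma Pic_trivial : (forall L : invertible X, omodule_iso (osheaf X) L) ->
  forall L : Pic X, L = Pic1 X.
Proof.
move=> triv [C hC]; rewrite /Pic1.
have E : C = iso_class (osheaf_invertible X).
  have [L ->] := hC; apply/funext => M; apply/propext; split=> h.
    exact: omodule_iso_trans (triv L) h.
  exact: omodule_iso_trans (omodule_iso_sym (triv L)) h.
by move: hC; rewrite E => hC; congr PicClass; exact: Prop_irrelevance.
Qed.

End PicTrivial.

(** * The resultant of a pair of binary forms *)

Section Resultant.
Variables (k : closedFieldType) (d : nat).
Implicit Types (F G : 'rV[k]_d.+1) (f : 'M[k]_2) (v w : 'rV[k]_(d.+1 + d.+1)) (x y : k).

Definition bform_at F x y : k := bform_eval (B := k^o) F x y.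

Lemma bform_atE F x y : bform_at F x y = \sum_(i < d.+1) F 0 i * (x ^+ i * y ^+ (d - i)).
Proof. by []. Qed.

Lemma bform_at_subst f F x y : bform_at (bform_subst f F) x y =
  bform_at F (f 0 0 * x + f 0 1 * y) (f 1 0 * x + f 1 1 * y).
Proof. exact: (bform_eval_subst (B := k^o)). Qed.

Lemma bform_at_linear x y a b F G :
  bform_at (a *: F - b *: G) x y = a * bform_at F x y - b * bform_at G x y.
Proof.
rewrite !bform_atE !mulr_sumr -sumrB; apply: eq_bigr => i _.
by rewrite !mxE; ring.
Qed.

Definition common_zero v x y :=
  [/\ (x != 0) || (y != 0), bform_at (lsubmx v) x y = 0 & bform_at (rsubmx v) x y = 0].

Definition pair_res v := bform_resultant (lsubmx v) (rsubmx v).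

Hypothesis d_gt0 : (0 < d)%N.

Lemma bform_band_at F x y (i : 'I_d) :
  \sum_(j < d + d) bform_band F i j * (x ^+ j * y ^+ (d + d.-1 - j)) =
  bform_at F x y * (x ^+ i * y ^+ (d.-1 - i)).
Proof.
under eq_bigr do rewrite mxE.
pose E j := (rVpoly F * 'X^i)`_j * (x ^+ j * y ^+ (d + d.-1 - j)).
transitivity (\sum_(j < (d + d.-1).+1) E j).
  rewrite -!(big_mkord xpredT E); congr (\sum_(0 <= j < _) _).
  by rewrite -addnS prednK.
have sF : (size (rVpoly F) <= d.+1)%N by exact: size_poly.
have sX : (size ('X^i : {poly k}) <= d.-1.+1)%N by rewrite size_polyXn prednK.
have := @bform_eval_polyM k k^o x y d d.-1 _ _ sF sX.
rewrite -/(\sum_(j < (d + d.-1).+1) E j) => ->; congr (_ * _).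
  by rewrite bform_atE; apply: eq_bigr => j _; rewrite coef_rVpoly_ord.
have lt : (i < d.-1.+1)%N by rewrite prednK.
rewrite (bigD1 (Ordinal lt)) //= coefXn eqxx big1 => [|j]; first by rewrite addr0 scale1r.
by rewrite -val_eqE /= coefXn => /negbTE->; rewrite scale0r.
Qed.

(** The Sylvester matrix kills the vector of monomials of degree 2d - 1 at the common zero. This
    vector is nonzero: its first entry is a power of [y], its last one a power of [x]. *)
Lemma common_zero_pair_res v x y : common_zero v x y -> pair_res v = 0.
Proof.
move=> [xy0 Fxy Gxy]; apply/eqP; apply: contraPT isT => detM.
pose c : 'cV[k]_(d + d) := \col_j (x ^+ j * y ^+ (d + d.-1 - j)).
rewrite /pair_res /bform_resultant in detM; set M := col_mx _ _ in detM.
have Mu : M \in unitmx by rewrite unitmxE unitfE.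
have Mc : M *m c = 0.
  rewrite /M mul_col_mx -[0]vsubmxK !linear0; congr col_mx; apply/colP => i.
    rewrite !mxE; under eq_bigr do rewrite [c _ _]mxE.
    by rewrite bform_band_at Fxy mul0r.
  rewrite !mxE; under eq_bigr do rewrite [c _ _]mxE.
  by rewrite bform_band_at Gxy mul0r.
have : c = 0 by rewrite -[c](mulKmx Mu) Mc mulmx0.
have lt0 : (0 < d + d)%N by rewrite addn_gt0 d_gt0.
have lt1 : (d + d.-1 < d + d)%N by rewrite ltn_add2l prednK.
have [y0|y0] := eqVneq y 0.
  move/colP/(_ (Ordinal lt1)); rewrite !mxE /= subnn expr0 mulr1 => /eqP.
  by rewrite y0 eqxx orbF in xy0; rewrite expf_eq0 (negbTE xy0) andbF.
move/colP/(_ (Ordinal lt0)); rewrite !mxE /= expr0 mul1r => /eqP.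
by rewrite expf_eq0 (negbTE y0) andbF.
Qed.

Lemma rVpoly_at F x : (rVpoly F).[x] = bform_at F x 1.
Proof.
rewrite bform_atE (horner_coef_wide _ (size_poly _ _)).
by apply: eq_bigr => i _; rewrite coef_rVpoly_ord expr1n mulr1.
Qed.

Lemma bform_at_infinity F : bform_at F 1 0 = (rVpoly F)`_d.
Proof.
rewrite bform_atE big_ord_recr /= subnn expr1n mulr1 mulr1 big1 ?add0r.
  by rewrite -(coef_rVpoly_ord F ord_max).
by move=> i _; rewrite expr0n subn_eq0 leqNgt ltn_ord !mulr0.
Qed.

Lemma mul_bform_band (a : 'rV[k]_d) F (j : 'I_(d + d)) :
  (a *m bform_band F) 0 j = (rVpoly a * rVpoly F)`_j.
Proof.
have -> : rVpoly a = \sum_(i < d) a 0 i *: 'X^i.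
  by rewrite /rVpoly poly_def; apply: eq_bigr => i _; rewrite valK.
rewrite mxE mulr_suml coef_sum; apply: eq_bigr => i _.
by rewrite mxE -scalerAl coefZ ['X^i * _]mulrC.
Qed.

(** A row in the kernel is a relation aF + bG = 0 with a, b of degree less than d. Without common
    zeros F and G are coprime, and one of them has degree exactly d for want of a zero at infinity;
    it divides the cofactor of the other, which is too small, so a = b = 0. *)
Lemma pair_res_common_zero v : pair_res v = 0 -> exists x y, common_zero v x y.
Proof.
move=> /eqP/det0P[u u0]; rewrite -[u]hsubmxK mul_row_col.
set a := lsubmx u; set b := rsubmx u; set F := lsubmx v; set G := rsubmx v => uM.
apply: contrapT => nz.
have {}nz x y : (x != 0) || (y != 0) -> bform_at F x y = 0 -> bform_at G x y <> 0.
  by move=> xy Fxy Gxy; apply: nz; exists x, y.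
have e : rVpoly a * rVpoly F = - (rVpoly b * rVpoly G).
  apply/polyP => j; have [lt|le] := ltnP j (d + d).
    have := congr1 (fun z : 'rV[k]_(d + d) => z 0 (Ordinal lt)) uM.
    rewrite [LHS]mxE !mul_bform_band mxE /= => /eqP.
    by rewrite addr_eq0 coefN => /eqP.
  have sz (c : 'rV[k]_d) (H : 'rV[k]_d.+1) : (rVpoly c * rVpoly H)`_j = 0.
    apply: nth_default; apply: leq_trans le.
    have sc : (size (rVpoly c) <= d)%N by exact: size_poly.
    have sH : (size (rVpoly H) <= d.+1)%N by exact: size_poly.
    apply: leq_trans (size_polyMleq _ _) _.
    by have := leq_add sc sH; rewrite addnS; case: (_ + _)%N.
  by rewrite coefN !sz oppr0.
have ab0 : (rVpoly a != 0) || (rVpoly b != 0).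
  apply: contraNT u0; rewrite negb_or !negbK => /andP[/eqP a0 /eqP b0].
  by rewrite -[u]hsubmxK -/a -/b -[a]rVpolyK -[b]rVpolyK a0 b0 !linear0 row_mx0.
have FG0 : (rVpoly F != 0) || (rVpoly G != 0).
  rewrite -negb_and; apply/negP => /andP[/eqP F0 /eqP G0].
  by apply: (@nz 1 0); rewrite ?oner_eq0 // bform_at_infinity ?F0 ?G0 coef0.
have cop : coprimep (rVpoly F) (rVpoly G).
  rewrite /coprimep; apply/negP => /negP/closed_rootP[x].
  rewrite root_gcd => /andP[/rootP Fx /rootP Gx].
  by apply: (@nz x 1); rewrite ?oner_eq0 ?orbT // -rVpoly_at.
have sz (c : 'rV[k]_d) (H : 'rV[k]_d.+1) :
    (rVpoly H)`_d != 0 -> rVpoly H %| rVpoly c -> rVpoly c = 0.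
  move=> Hd Hc; apply/eqP; apply: contraPT isT => c0.
  have := dvdp_leq c0 Hc; have : (size (rVpoly c) <= d)%N by exact: size_poly.
  move=> h1 h2; have := leq_trans h2 h1; rewrite leqNgt.
  by rewrite (contraNltn _ Hd) // => ?; rewrite nth_default.
have [Fd|Fd] := eqVneq (rVpoly F)`_d 0.
  have Gd : (rVpoly G)`_d != 0.
    apply/eqP; rewrite -bform_at_infinity; apply: nz; rewrite ?oner_eq0 //.
    by rewrite bform_at_infinity.
  have G0 : rVpoly G != 0 by apply: contraNneq Gd => ->; rewrite coef0.
  have a0 : rVpoly a = 0.
    apply: (sz _ _ Gd); rewrite -(Gauss_dvdpl _ (q := rVpoly F)) 1?coprimep_sym //.
    by rewrite e dvdpNr dvdp_mulIr.
  move: e ab0; rewrite a0 mul0r eqxx => /esym/eqP.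
  by rewrite oppr_eq0 mulf_eq0 (negbTE G0) orbF => ->.
have F0 : rVpoly F != 0 by apply: contraNneq Fd => ->; rewrite coef0.
have b0 : rVpoly b = 0.
  apply: (sz _ _ Fd); rewrite -(Gauss_dvdpl _ (q := rVpoly G)) //.
  by rewrite -dvdpNr -e dvdp_mulIr.
move: e ab0; rewrite b0 mul0r oppr0 eqxx => /eqP.
by rewrite mulf_eq0 (negbTE F0) orbF => ->.
Qed.

Lemma det_mx22 f : \det f = f 0 0 * f 1 1 - f 0 1 * f 1 0.
Proof.
rewrite (expand_det_row _ 0) !big_ord_recl big_ord0 addr0 /cofactor !det_mx11 !mxE /=.
rewrite expr0 expr1 mul1r mulN1r mulrN.
by congr (_ * f _ _ - f _ _ * f _ _); apply: val_inj.
Qed.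

(** The values of the conjugate at a point are [f]^-1 applied to the values of [v] at the image
    point, so applying [f] recovers the latter. *)
Lemma conj_pair_common_zero f v x y : \det f = 1 -> common_zero (conj_pair f v) x y ->
  common_zero v (f 0 0 * x + f 0 1 * y) (f 1 0 * x + f 1 1 * y).
Proof.
rewrite det_mx22 => det_f [xy0].
rewrite row_mxKl row_mxKr !bform_at_linear !bform_at_subst.
pose x' := f 0 0 * x + f 0 1 * y; pose y' := f 1 0 * x + f 1 1 * y.
set F := bform_at _ _ _; set G := bform_at _ _ _ => e1 e2; split.
- rewrite -negb_and; apply: contraTN xy0 => /andP[/eqP x0 /eqP y0].
  rewrite negb_or !negbK; apply/andP; split; apply/eqP.
    transitivity (f 1 1 * x' - f 0 1 * y'); last by rewrite /x' /y' x0 y0; ring.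
    by rewrite -[LHS]mul1r -det_f /x' /y'; ring.
  transitivity (f 0 0 * y' - f 1 0 * x'); last by rewrite /x' /y' x0 y0; ring.
  by rewrite -[LHS]mul1r -det_f /x' /y'; ring.
- rewrite -/F -[LHS]mul1r -det_f.
  transitivity (f 0 0 * (f 1 1 * F - f 0 1 * G) + f 0 1 * (f 0 0 * G - f 1 0 * F)).
    by ring.
  by rewrite e1 e2; ring.
- rewrite -/G -[LHS]mul1r -det_f.
  transitivity (f 1 0 * (f 1 1 * F - f 0 1 * G) + f 1 1 * (f 0 0 * G - f 1 0 * F)).
    by ring.
  by rewrite e1 e2; ring.
Qed.

(** Common zeros are moved by the inverse of [f]. The exact invariance of the resultant is deduced
    later from this nonvanishing, without any transformation formula. *)
Lemma pair_res_conj_neq0 f v : \det f = 1 ->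
  pair_res v != 0 -> pair_res (conj_pair f v) != 0.
Proof.
move=> det_f; apply: contra_neq => /pair_res_common_zero[x [y]].
by move=> /(conj_pair_common_zero det_f); exact: common_zero_pair_res.
Qed.

Definition mpoly_band (s : 'I_d.+1 -> 'I_(d.+1 + d.+1)) :
    'M[{mpoly k[d.+1 + d.+1]}]_(d, d + d) :=
  \matrix_(i, j) if (j < i)%N then 0 else
    if insub (j - i)%N is Some l then 'X_(s l) else 0.

Definition mpoly_res : {mpoly k[d.+1 + d.+1]} :=
  \det (col_mx (mpoly_band (@lshift _ _)) (mpoly_band (@rshift _ _))).

Lemma mpoly_band_homog s i j : mpoly_band s i j \is 1.-homog.
Proof.
rewrite mxE; case: ifP => _; first exact: dhomog0.
by case: insub => [l|]; [rewrite dhomogX; exact/eqP/mdeg1 | exact: dhomog0].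
Qed.

Lemma dhomog_prod1 n m (F : 'I_m -> {mpoly k[n]}) :
  (forall i, F i \is 1.-homog) -> \prod_i F i \is m.-homog.
Proof.
elim: m F => [|m IH] F hF; first by rewrite big_ord0 dhomog1.
rewrite big_ord_recl; apply: (@dhomogM _ _ _ 1%N _ m) => //; exact: IH.
Qed.

(** Each of the 2d rows contributes one linear entry to every term; this degree is the modulus of
    the later congruences on weights. *)
Lemma mpoly_res_homog : mpoly_res \is (d + d).-homog.
Proof.
rewrite /mpoly_res; set M := col_mx _ _.
have h (g : 'I_(d + d) -> 'I_(d + d)) : \prod_i M i (g i) \is (d + d).-homog.
  apply: dhomog_prod1 => i; rewrite mxE.
  by case: splitP => j _; exact: mpoly_band_homog.
apply: rpred_sum => s _; rewrite mulr_sign.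
by case: ifP => _; rewrite ?rpredN; exact: h.
Qed.

Lemma peval_pair_res v : peval mpoly_res v = pair_res v.
Proof.
rewrite /peval /mpoly_res -det_map_mx map_col_mx; congr (\det (col_mx _ _)).
  apply/matrixP => i j; rewrite !mxE coefMXn; case: ltnP => _ /=; first exact: meval0.
  by rewrite coef_rVpoly; case: insub => [l|]; rewrite ?meval0 // mevalXU mxE.
apply/matrixP => i j; rewrite !mxE coefMXn; case: ltnP => _ /=; first exact: meval0.
by rewrite coef_rVpoly; case: insub => [l|]; rewrite ?meval0 // mevalXU mxE.
Qed.

End Resultant.

(** * Invariance under conjugation *)

Section PolynomialFamilies.
Variable k : closedFieldType.
Implicit Types (h : k -> k) (a b c : k).

Definition polyfun h := exists q : {poly k}, forall a, h a = q.[a].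

Lemma polyfunC c : polyfun (fun _ => c).
Proof. by exists c%:P => a; rewrite hornerC. Qed.

Lemma polyfunX : polyfun id.
Proof. by exists 'X => a; rewrite hornerX. Qed.

Lemma polyfunD h h' : polyfun h -> polyfun h' -> polyfun (fun a => h a + h' a).
Proof. by move=> [q qE] [q' q'E]; exists (q + q') => a; rewrite hornerD qE q'E. Qed.

Lemma polyfunM h h' : polyfun h -> polyfun h' -> polyfun (fun a => h a * h' a).
Proof. by move=> [q qE] [q' q'E]; exists (q * q') => a; rewrite hornerM qE q'E. Qed.

Lemma polyfunB h h' : polyfun h -> polyfun h' -> polyfun (fun a => h a - h' a).
Proof. by move=> [q qE] [q' q'E]; exists (q - q') => a; rewrite hornerD hornerN qE q'E. Qed.

Lemma polyfunXn h n : polyfun h -> polyfun (fun a => h a ^+ n).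
Proof. by move=> [q qE]; exists (q ^+ n) => a; rewrite horner_exp qE. Qed.

Lemma polyfun_sum (I : Type) (r : seq I) (h : I -> k -> k) :
  (forall i, polyfun (h i)) -> polyfun (fun a => \sum_(i <- r) h i a).
Proof.
move=> /choice[q qE]; exists (\sum_(i <- r) q i) => a.
by rewrite horner_sum; apply: eq_bigr.
Qed.

Lemma polyfun_prod (I : Type) (r : seq I) (h : I -> k -> k) :
  (forall i, polyfun (h i)) -> polyfun (fun a => \prod_(i <- r) h i a).
Proof.
move=> /choice[q qE]; exists (\prod_(i <- r) q i) => a.
by rewrite horner_prod; apply: eq_bigr.
Qed.

Lemma polyfun_peval n (p : {mpoly k[n]}) (w : k -> 'rV[k]_n) :
  (forall j, polyfun (fun a => w a 0 j)) -> polyfun (fun a => peval p (w a)).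
Proof.
move=> hw; rewrite /peval (_ : (fun a => _) =
    fun a => \sum_(m <- msupp p) p@_m * \prod_i w a 0 i ^+ m i); last first.
  by apply/funext => a; rewrite mevalE.
apply: polyfun_sum => m; apply: polyfunM; first exact: polyfunC.
by apply: polyfun_prod => i; exact: polyfunXn.
Qed.

Lemma poly_infinite_eq (f p q : {poly k}) : f != 0 ->
  (forall a, f.[a] != 0 -> p.[a] = q.[a]) -> p = q.
Proof.
move=> f0 fpq; apply/eqP; rewrite -subr_eq0; apply: contraPT isT => pq0.
have /closed_nonrootP[a] := mulf_neq0 f0 pq0.
rewrite rootM negb_or => /andP[fa].
by rewrite /root hornerD hornerN fpq // subrr eqxx.
Qed.

(** The local fractions agree on dense open sets, so a single reduced fraction represents [h]
    everywhere. Coprimality prevents its numerator and denominator from having roots, and over a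
    closed field they are then constants. *)
Lemma unit_line_const h :
  (forall a0, exists f P Q : {poly k}, f.[a0] != 0 /\ forall a, f.[a] != 0 ->
     [/\ P.[a] != 0, Q.[a] != 0 & h a = P.[a] / Q.[a]]) ->
  forall a b, h a = h b.
Proof.
move=> loc; have [f [P [Q [f0 hf]]]] := loc 0.
have horner_neq0 (p : {poly k}) x : p.[x] != 0 -> p != 0.
  by apply: contra_neq => ->; rewrite horner0.
have [P00 Q00 _] := hf 0 f0.
have P0 := horner_neq0 _ _ P00; have Q0 := horner_neq0 _ _ Q00.
have g0 : gcdp P Q != 0 by rewrite gcdp_eq0 negb_and P0.
have PE := divpK (dvdp_gcdl P Q); have QE := divpK (dvdp_gcdr P Q).
set P1 := P %/ gcdp P Q in PE; set Q1 := Q %/ gcdp P Q in QE.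
have cop : coprimep P1 Q1 by apply: coprimep_div_gcd; rewrite P0.
have key b : P1.[b] != 0 /\ Q1.[b] != 0 /\ h b = P1.[b] / Q1.[b].
  have [f' [P' [Q' [f'b hf']]]] := loc b.
  have e : P * Q' = P' * Q.
    apply: (poly_infinite_eq (mulf_neq0 (horner_neq0 _ _ f0) (horner_neq0 _ _ f'b))) => a.
    rewrite hornerM mulf_eq0 negb_or => /andP[/hf[_ Qa ha] /hf'[_ Q'a]].
    by rewrite ha => /eqP; rewrite eqr_div // !hornerM => /eqP.
  have {}e : P1 * Q' = P' * Q1.
    apply: (mulIf g0); rewrite -[RHS]mulrA QE -e -[in RHS]PE.
    by rewrite mulrAC.
  have eb : P1.[b] * Q'.[b] = P'.[b] * Q1.[b] by rewrite -!hornerM e.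
  have [P'b Q'b hb] := hf' b f'b.
  have Q1b : Q1.[b] != 0.
    apply/eqP => Q1b; move: eb; rewrite Q1b mulr0 => /eqP.
    rewrite mulf_eq0 (negbTE Q'b) orbF => P1b.
    by have := coprimep_root cop P1b; rewrite Q1b eqxx.
  have P1b : P1.[b] != 0.
    apply: contraNneq (mulf_neq0 P'b Q1b) => P1b.
    by rewrite -eb P1b mul0r.
  by split=> //; split=> //; rewrite hb; apply/eqP; rewrite eqr_div // eb.
have const (R : {poly k}) : (forall b, R.[b] != 0) -> forall a b, R.[a] = R.[b].
  move=> Rb; have /size_poly1P[c _ ->] : size R == 1%N.
    by apply: contraT => /closed_rootP[b /rootP Rb0]; have := Rb b; rewrite Rb0 eqxx.
  by move=> a b; rewrite !hornerC.
move=> a b; have [_ [_ ->]] := key a; have [_ [_ ->]] := key b.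
by congr (_ / _); apply: const => c; have [? []] := key c.
Qed.

End PolynomialFamilies.

Section Conjugation.
Variables (k : closedFieldType) (d : nat).
Local Notation vec := 'rV[k]_(d.+1 + d.+1).
Implicit Types (f : 'M[k]_2) (v w : vec) (T : vec -> k).

Lemma polyfun_conj_pair (f : k -> 'M[k]_2) v :
  (forall i j, polyfun (fun a => f a i j)) ->
  forall j, polyfun (fun a => conj_pair (f a) v 0 j).
Proof.
move=> hf.
pose polyfam (P : k -> {poly k}) := forall j, polyfun (fun a => (P a)`_j).
have famM P Q : polyfam P -> polyfam Q -> polyfam (fun a => P a * Q a).
  move=> hP hQ j; rewrite (_ : (fun a => _) =
    fun a => \sum_(i < j.+1) (P a)`_i * (Q a)`_(j - i)); last first.
    by apply/funext => a; rewrite coefM.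
  by apply: polyfun_sum => i; exact: polyfunM.
have famX P n : polyfam P -> polyfam (fun a => P a ^+ n).
  move=> hP; elim: n => [|n IH] j.
    by under eq_fun do rewrite expr0; exact: polyfunC.
  by under eq_fun do rewrite exprS; exact: famM.
have famlin i : polyfam (fun a => f a i 0 *: 'X + (f a i 1)%:P).
  move=> j; under eq_fun do rewrite coefD coefZ coefC.
  apply: polyfunD; first by apply: polyfunM => //; exact: polyfunC.
  by case: (j == 0%N) => //; exact: polyfunC.
have subst (F : 'rV[k]_d.+1) j : polyfun (fun a => bform_subst (f a) F 0 j).
  rewrite (_ : (fun a => _) = fun a => \sum_(i < d.+1) F 0 i *
    ((f a 0 0 *: 'X + (f a 0 1)%:P) ^+ i * (f a 1 0 *: 'X + (f a 1 1)%:P) ^+ (d - i))`_j).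
    apply: polyfun_sum => i; apply: polyfunM; first exact: polyfunC.
    by apply: famM; exact: famX.
  apply/funext => a; rewrite mxE /bform_eval coef_sum.
  by apply: eq_bigr => i _; rewrite coefZ.
move=> j; case: (split_ordP j) => i ->.
  rewrite (_ : (fun a => _) = fun a => f a 1 1 * bform_subst (f a) (lsubmx v) 0 i -
      f a 0 1 * bform_subst (f a) (rsubmx v) 0 i).
    by apply: polyfunB; apply: polyfunM.
  by apply/funext => a; rewrite row_mxEl !mxE.
rewrite (_ : (fun a => _) = fun a => f a 0 0 * bform_subst (f a) (rsubmx v) 0 i -
    f a 1 0 * bform_subst (f a) (lsubmx v) 0 i).
  by apply: polyfunB; apply: polyfunM.
by apply/funext => a; rewrite row_mxEr !mxE.
Qed.

Definition upper a : 'M[k]_2 :=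
  \matrix_(i, j) (if i == j then 1 else if i == 0 then a else 0).
Definition lower a : 'M[k]_2 :=
  \matrix_(i, j) (if i == j then 1 else if i == 0 then 0 else a).

Lemma det_upper a : \det (upper a) = 1.
Proof. by rewrite det_mx22 !mxE /=; ring. Qed.

Lemma det_lower a : \det (lower a) = 1.
Proof. by rewrite det_mx22 !mxE /=; ring. Qed.

Lemma mx22_eq (f g : 'M[k]_2) :
  f 0 0 = g 0 0 -> f 0 1 = g 0 1 -> f 1 0 = g 1 0 -> f 1 1 = g 1 1 -> f = g.
Proof.
move=> e00 e01 e10 e11; apply/matrixP => i j.
have cases (l : 'I_2) : l = 0 \/ l = 1.
  by case: l => [[|[|l]] lt] //; [left|right]; exact: val_inj.
by case: (cases i) (cases j) => -> [] ->.
Qed.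

(** Three factors suffice when the lower left entry is nonzero; otherwise multiplication by
    [lower 1] makes it so, and the last factor undoes this. *)
Lemma SL2_elementary f : \det f = 1 -> exists a b c e,
  f = upper a *m lower b *m upper c *m lower e.
Proof.
rewrite det_mx22 => det_f.
have gen (g : 'M[k]_2) : g 0 0 * g 1 1 - g 0 1 * g 1 0 = 1 -> g 1 0 != 0 -> exists a b c,
    g = upper a *m lower b *m upper c.
  (* The product has first column (1 + ab, b) and lower right entry 1 + bc; the remaining entry is
     forced by the determinant. *)
  move=> det_g g10; exists ((g 0 0 - 1) / g 1 0), (g 1 0), ((g 1 1 - 1) / g 1 0).
  apply: mx22_eq; rewrite !mulmx2E !mxE /=; [by field| |by field|by field].
  apply: (mulIf g10); have -> : g 0 1 * g 1 0 = g 0 0 * g 1 1 - 1.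
    by rewrite -det_g; ring.
  by field.
have [f10|f10] := eqVneq (f 1 0) 0.
  have f11 : f 1 1 != 0.
    apply/eqP => f11; move: det_f; rewrite f10 f11 !mulr0 subr0 => /eqP.
    by rewrite eq_sym oner_eq0.
  have [||a [b [c E]]] := gen (f *m lower 1).
  - by rewrite !mulmx2E !mxE /= -[RHS]det_f; ring.
  - by rewrite !mulmx2E !mxE /= f10 mul0r add0r mulr1.
  exists a, b, c, (-1); rewrite -E.
  apply: mx22_eq; rewrite !mulmx2E !mxE /=; ring.
have [a [b [c E]]] := gen f det_f f10; exists a, b, c, 0; rewrite -E.
apply: mx22_eq; rewrite !mulmx2E !mxE /=; ring.
Qed.

(** Stated for any stable set [S] because it serves twice, for the functions T_i and for the
    resultant. *)
Lemma conj_pair_invariant (S : set vec) T :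
  (forall f v, \det f = 1 -> S v -> S (conj_pair f v)) ->
  (forall v, S v -> exists g P Q, peval g v != 0 /\ ratunit g P Q T) ->
  forall f v, \det f = 1 -> S v -> T (conj_pair f v) = T v.
Proof.
move=> stab loc.
(* T has no zeros on the curve a |-> u a . v, an affine line. *)
have oneparam (u : k -> 'M[k]_2) : (forall i j, polyfun (fun a => u a i j)) ->
    (forall a, \det (u a) = 1) -> u 0 = 1%:M ->
    forall a v, S v -> T (conj_pair (u a) v) = T v.
  move=> hu det_u u0 a v Sv; rewrite -[in RHS](conj_pair1 v) -u0.
  apply: (unit_line_const (h := fun a => T (conj_pair (u a) v))) => b.
  have [g [P [Q [gb gT]]]] := loc _ (stab _ _ (det_u b) Sv).
  have hc := polyfun_conj_pair v hu.
  have [g' g'E] := polyfun_peval g hc; have [P' P'E] := polyfun_peval P hc.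
  have [Q' Q'E] := polyfun_peval Q hc; exists g', P', Q'.
  by rewrite -g'E; split=> // c; rewrite -g'E -P'E -Q'E => /gT.
have up a v : S v -> T (conj_pair (upper a) v) = T v.
  apply: (oneparam upper) => [i j|b|]; [|exact: det_upper|].
    under eq_fun do rewrite mxE; case: (i == j); first exact: polyfunC.
    by case: (i == 0); [exact: polyfunX|exact: polyfunC].
  by apply: mx22_eq; rewrite !mxE.
have low a v : S v -> T (conj_pair (lower a) v) = T v.
  apply: (oneparam lower) => [i j|b|]; [|exact: det_lower|].
    under eq_fun do rewrite mxE; case: (i == j); first exact: polyfunC.
    by case: (i == 0); [exact: polyfunC|exact: polyfunX].
  by apply: mx22_eq; rewrite !mxE.
move=> f v /SL2_elementary[a [b [c [e ->]]]] Sv; rewrite -!conj_pairM.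
have S1 := stab _ _ (det_upper a) Sv; have S2 := stab _ _ (det_lower b) S1.
have S3 := stab _ _ (det_upper c) S2.
by rewrite low // up // low // up.
Qed.

End Conjugation.

(** * Maps with automorphisms *)

Section Weights.
Variables (k : closedFieldType) (d : nat).
Hypotheses (char_k : [pchar k] =i pred0) (d_gt1 : (1 < d)%N).
Local Notation vec := 'rV[k]_(d.+1 + d.+1).
Implicit Types (F G : 'rV[k]_d.+1) (v : vec) (s t c x y : k).

Definition diag2 t s : 'M[k]_2 :=
  \matrix_(i, j) (if i == j then if i == 0 then t else s else 0).

Lemma det_diag2 t s : \det (diag2 t s) = t * s.
Proof. by rewrite det_mx22 !mxE /=; ring. Qed.

Lemma bform_subst_diag2 t s F i :
  bform_subst (diag2 t s) F 0 i = t ^+ i * s ^+ (d - i) * F 0 i.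
Proof.
rewrite mxE /bform_eval !mxE /= scale0r addr0 add0r coef_sum (bigD1 i) //=.
have E j : F 0 j *: ((t *: 'X) ^+ j * s%:P ^+ (d - j)) =
    (F 0 j * (t ^+ j * s ^+ (d - j))) *: 'X^j.
  by rewrite exprZn -rmorphXn [_ * _%:P]mulrC mul_polyC !scalerA; congr (_ *: _); ring.
rewrite big1 => [|j ji]; last first.
  by rewrite E coefZ coefXn val_eqE eq_sym (negbTE ji) mulr0.
by rewrite addr0 E coefZ coefXn eqxx mulr1 mulrC.
Qed.

(** Diagonal matrices scale each monomial, so only the monomials that occur in [F] and [G] must
    share the factor [c]. *)
Lemma conj_pair_diag2 t s c F G : t * s = 1 ->
  (forall i, F 0 i != 0 -> s * (t ^+ i * s ^+ (d - i)) = c) ->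
  (forall i, G 0 i != 0 -> t * (t ^+ i * s ^+ (d - i)) = c) ->
  conj_pair (diag2 t s) (row_mx F G) = c *: row_mx F G.
Proof.
move=> ts hF hG; rewrite /conj_pair row_mxKl row_mxKr scale_row_mx.
have -> : diag2 t s 1 1 = s by rewrite mxE.
have -> : diag2 t s 0 1 = 0 by rewrite mxE.
have -> : diag2 t s 0 0 = t by rewrite mxE.
have -> : diag2 t s 1 0 = 0 by rewrite mxE.
rewrite !scale0r !subr0; congr row_mx; apply/rowP => i.
  rewrite [LHS]mxE [RHS]mxE bform_subst_diag2.
  by have [->|/hF <-] := eqVneq (F 0 i) 0; rewrite ?mulr0 // mulrA.
rewrite [LHS]mxE [RHS]mxE bform_subst_diag2.
by have [->|/hG <-] := eqVneq (G 0 i) 0; rewrite ?mulr0 // mulrA.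
Qed.

Lemma bform_at_delta (i : 'I_d.+1) x y :
  bform_at (delta_mx 0 i) x y = x ^+ i * y ^+ (d - i).
Proof.
rewrite bform_atE (bigD1 i) //= mxE !eqxx mul1r big1 ?addr0 // => j ji.
by rewrite mxE eqxx (negbTE ji) mul0r.
Qed.

Lemma bform_atD F G x y : bform_at (F + G) x y = bform_at F x y + bform_at G x y.
Proof.
by rewrite !bform_atE -big_split; apply: eq_bigr => i _; rewrite mxE mulrDl.
Qed.

Let d_gt0 : (0 < d)%N := ltnW d_gt1.

(* [X^d : Y^d] *)
Definition power_map : vec := row_mx (delta_mx 0 ord_max) (delta_mx 0 ord0).

Lemma power_map_res : pair_res power_map != 0.
Proof.
apply/eqP => /pair_res_common_zero[x [y [+ ]]].
rewrite row_mxKl row_mxKr !bform_at_delta subnn subn0 !expr0 mulr1 mul1r.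
move=> + /eqP + /eqP; rewrite !expf_eq0 d_gt0 /= => xy0 /eqP x0 /eqP y0.
by rewrite x0 y0 eqxx in xy0.
Qed.

(* [X^d + Y^d : X^(d-1) Y] *)
Definition cyclic_map : vec :=
  row_mx (delta_mx 0 ord_max + delta_mx 0 ord0) (delta_mx 0 (inord d.-1)).

Lemma cyclic_map_res : pair_res cyclic_map != 0.
Proof.
apply/eqP => /pair_res_common_zero[x [y [+ ]]].
have d1 : (d.-1 < d.+1)%N by rewrite prednK // ltnW.
rewrite row_mxKl row_mxKr bform_atD !bform_at_delta subnn subn0 !expr0 mulr1 mul1r.
rewrite inordK // => xy0 e /eqP; rewrite mulf_eq0 !expf_eq0.
move=> /orP[/andP[_ /eqP x0]|/andP[_ /eqP y0]].
  move: e xy0; rewrite x0 expr0n eqn0Ngt d_gt0 add0r eqxx => /eqP.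
  by rewrite expf_eq0 d_gt0 => /= ->.
move: e xy0; rewrite y0 expr0n eqn0Ngt d_gt0 addr0 eqxx orbF => /eqP.
by rewrite expf_eq0 d_gt0 => /= ->.
Qed.

(** In characteristic 0 the polynomial 'X^n - 1 is separable, hence has n distinct roots. *)
Lemma prim_root_exists n : (0 < n)%N -> exists z : k, n.-primitive_root z.
Proof.
pose p : {poly k} := 'X^n - 1; have [r Dp] := closed_field_poly_normal p.
move=> n_gt0; rewrite (monicP _) ?monicXnsubC // scale1r in Dp.
have rn1 : all n.-unity_root r by apply/allP=> z; rewrite -root_prod_XsubC -Dp.
have sz_r : (n < (size r).+1)%N.
  by rewrite -(size_prod_XsubC r id) -Dp size_XnsubC.
have [|z] := hasP (has_prim_root n_gt0 rn1 _ sz_r); last by exists z.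
rewrite -separable_prod_XsubC -Dp separable_Xn_sub_1 //.
by have /pcharf0P -> := char_k; rewrite -lt0n.
Qed.

(** Since d - 1 and d are coprime, d - 1 is invertible modulo 2d for even d. For odd d it is
    invertible only modulo d, and the parity hypothesis restores the factor 2. *)
Lemma modn_pred_double a b :
  (d.-1 * a = d.-1 * b %[mod d + d])%N -> odd a = odd b -> (a = b %[mod d + d])%N.
Proof.
wlog le : a b / (b <= a)%N.
  move=> H; have [le|/ltnW le] := leqP b a; first exact: H.
  by move=> e /esym o; apply/esym; apply: H (esym e) o.
move=> /eqP; rewrite eqn_mod_dvd ?leq_mul2l ?le ?orbT // -mulnBr => dvd oab.
apply/eqP; rewrite eqn_mod_dvd //; set e := (a - b)%N in dvd *.
have e2 : (2 %| e)%N by rewrite dvdn2 /e oddB // oab addbb.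
have cop : coprime d d.-1 by rewrite coprime_sym -{2}(prednK d_gt0) coprimenS.
rewrite addnn -mul2n in dvd *; have [od|ed] := boolP (odd d).
  rewrite Gauss_dvd ?coprime2n // e2 -(Gauss_dvdr _ cop).
  by apply: dvdn_trans dvd; exact: dvdn_mull.
rewrite -(Gauss_dvdr _ (n := d.-1)) // coprimeMl cop andbT coprime2n.
by rewrite -(negbK (odd _)) -oddS prednK.
Qed.

Lemma weight_eq a b :
  (forall f v c, \det f = 1 -> pair_res v != 0 -> conj_pair f v = c *: v ->
     c != 0 -> c ^+ a = c ^+ b) ->
  (a = b %[mod d + d])%N.
Proof.
move=> stab; apply: modn_pred_double.
  have dd_gt0 : (0 < d + d)%N by rewrite addn_gt0 d_gt0.
  have [t t_prim] := prim_root_exists dd_gt0.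
  have t1 := prim_expr_order t_prim.
  have t0 : t != 0.
    by apply: contra_eq_neq t1 => ->; rewrite expr0n gtn_eqF // eq_sym oner_eq0.
  apply/eqP; rewrite -(eq_prim_root_expr t_prim) !exprM; apply/eqP.
  apply: (stab (diag2 t t^-1) cyclic_map); rewrite ?det_diag2 ?divff ?expf_neq0 //.
    exact: cyclic_map_res.
  have d1 : (d.-1 < d.+1)%N by rewrite prednK // ltnW.
  (* This is where the order 2d of [t] matters: it gives Y^d the same factor t^(d-1) as X^d and
     X^(d-1) Y. *)
  have tV : t^-1 ^+ d = t ^+ d.
    by apply: (mulfI (expf_neq0 d t0)); rewrite -exprMn divff // expr1n -exprD t1.
  have td : t^-1 * t ^+ d = t ^+ d.-1 by rewrite -{1}(prednK d_gt0) exprS mulKf.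
  apply: conj_pair_diag2; first by rewrite divff.
    move=> i; rewrite !mxE eqxx /=.
    have [->|im] := eqVneq i ord_max; first by rewrite subnn expr0 mulr1 td.
    have [->|i0] := eqVneq i ord0; first by rewrite subn0 expr0 mul1r tV td.
    by rewrite addr0 eqxx.
  move=> i; rewrite mxE eqxx /=.
  have [-> _|_] := eqVneq i (inord d.-1); last by rewrite eqxx.
  rewrite inordK // mulrA -exprS (_ : d - d.-1 = 1)%N ?expr1.
    by rewrite prednK // mulrC td.
  by rewrite -{1}(prednK d_gt0) subSnn.
have d1_gt0 : (0 < d.-1)%N by rewrite -ltnS prednK.
(* On [X^d : Y^d] the two factors are t^(d-1) and t^(1-d), which coincide when t^(d-1) = -1. The
   resulting scalar -1 compares the parities of [a] and [b]. *)
have [t] : exists t : k, root ('X^(d.-1) + 1) t.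
  apply/closed_rootP; rewrite size_polyDl ?size_polyXn ?size_poly1 //.
  by rewrite -[in X in X != _](prednK d1_gt0).
rewrite /root hornerD hornerXn hornerC addr_eq0 => /eqP t1.
have t0 : t != 0.
  by apply: contra_eq_neq t1 => ->; rewrite expr0n gtn_eqF // eq_sym oppr_eq0 oner_eq0.
have N1 : (-1 : k) != 0 by rewrite oppr_eq0 oner_eq0.
have td : t ^+ d = t * t ^+ d.-1 by rewrite -exprS prednK.
have conjE : conj_pair (diag2 t t^-1) power_map = -1 *: power_map.
  apply: conj_pair_diag2; first by rewrite divff.
    move=> i; rewrite mxE eqxx /=; have [-> _|_] := eqVneq i ord_max; last by rewrite eqxx.
    by rewrite subnn expr0 mulr1 /= td mulKf.
  move=> i; rewrite mxE eqxx /=; have [-> _|_] := eqVneq i ord0; last by rewrite eqxx.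
  by rewrite subn0 expr0 mul1r exprVn td invfM mulVKf // t1 invrN invr1.
have := stab _ _ _ _ power_map_res conjE N1.
rewrite det_diag2 divff // => /(_ erefl); rewrite -signr_odd -[RHS]signr_odd.
have N11 : (-1 : k) != 1.
  rewrite -subr_eq0 -opprD oppr_eq0 -(natrD _ 1 1).
  by have /pcharf0P -> := char_k.
case: (odd a) (odd b) => [] [] // /eqP; rewrite ?expr0 ?expr1.
  by rewrite (negbTE N11).
by rewrite eq_sym (negbTE N11).
Qed.

End Weights.

(** * The moduli space *)

Lemma pevalZ (k : closedFieldType) n (p : {mpoly k[n]}) e c v :
  p \is e.-homog -> peval p (c *: v) = c ^+ e * peval p v.
Proof.
move=> /dhomogP hp; rewrite /peval !mevalE mulr_sumr !big_seq.
apply: eq_bigr => m /hp /= me; rewrite mulrCA -me mdegE -prodrXr -big_split /=.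
by congr (_ * _); apply: eq_bigr => i _; rewrite mxE exprMn.
Qed.

Section RatSpace.
Variables (k : closedFieldType) (d : nat).
Hypotheses (char_k : [pchar k] =i pred0) (d_gt1 : (1 < d)%N).
Local Notation vec := 'rV[k]_(d.+1 + d.+1).
Local Notation R := (Rat_space k d).
Local Notation M := (M_space k d).
Implicit Types (v w : vec) (z : R).

Let d_gt0 : (0 < d)%N := ltnW d_gt1.

Definition coords z : vec := hcoord (val z).

Definition proj : R -> M := @quot_pi k R (ratmap_conj_rel k d).

Lemma coords_line z v : val (val z) = <[v]>%VS -> exists2 c, c != 0 & coords z = c *: v.
Proof. exact: hcoordP. Qed.

Lemma pair_resZ c v : pair_res (c *: v) = c ^+ (d + d) * pair_res v.
Proof. by rewrite -!peval_pair_res (pevalZ _ _ (mpoly_res_homog k d)). Qed.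

Lemma pair_resZ_neq0 c v : c != 0 -> (pair_res (c *: v) != 0) = (pair_res v != 0).
Proof. by move=> c0; rewrite pair_resZ mulf_eq0 expf_eq0 (negbTE c0) andbF. Qed.

Lemma pair_res_coords z : pair_res (coords z) != 0.
Proof. exact: (set_valP z). Qed.

Lemma line_exists v : pair_res v != 0 -> exists z, val (val z) = <[v]>%VS.
Proof.
move=> v0; have dim1 : \dim <[v]>%VS == 1%N.
  rewrite dim_vline; suff -> : v != 0 by [].
  apply: contra_neq v0 => ->; rewrite -(scale0r 0) pair_resZ expr0n addn_eq0.
  by rewrite eqn0Ngt d_gt0 mul0r.
pose x : projspace k (d.+1 + d.+1) := exist _ <[v]>%VS dim1.
have xR : Rat_set x.
  have [|c c0 e] := @hcoordP _ _ x v; first by [].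
  by rewrite /Rat_set /= -/(pair_res _) e pair_resZ_neq0.
by exists (exist _ x (mem_set xR)).
Qed.

(** A total map from vectors to points needs a default where the resultant vanishes; [power_map]
    shows that Rat_d has a point. *)
Lemma line_choice : exists rat_of : vec -> R,
  forall v, pair_res v != 0 -> val (val (rat_of v)) = <[v]>%VS.
Proof.
have [z0 _] := line_exists (power_map_res k d_gt1).
suff /choice[f fP] : forall v, exists z, pair_res v != 0 -> val (val z) = <[v]>%VS.
  by exists f.
move=> v; have [v0|v0] := eqVneq (pair_res v) 0; first by exists z0.
by have [z zE] := line_exists v0; exists z.
Qed.

Lemma Rat_open_basis (U : set R) z : open U -> U z -> exists f e,
  [/\ f \is e.-homog, peval f (coords z) != 0 &
      forall z', peval f (coords z') != 0 -> U z'].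
Proof.
move=> [A oA <-] Az; have /zariski_openP/(_ _ Az)[f [[e hf] fz fA]] := oA.
exists f, e; split=> //; first exact/eqP.
by move=> z' /eqP; exact: fA.
Qed.

Lemma Rat_open_nonzero f e : f \is e.-homog -> open [set z | peval f (coords z) != 0].
Proof.
move=> hf; exists [set x | heval f x != 0]; last by [].
apply/zariski_openP => x fx; exists f; split; [by exists e|exact/eqP|].
by move=> y /eqP.
Qed.

Lemma Rat_regular (U : opens R) (Phi : R -> k) :
  (forall z, opens_set U z -> exists f P Q e m,
     [/\ f \is e.-homog, peval f (coords z) != 0, P \is m.-homog, Q \is m.-homog &
         forall z', peval f (coords z') != 0 ->
         [/\ opens_set U z', peval Q (coords z') != 0 &
            Phi z' = peval P (coords z') / peval Q (coords z')]]) ->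
  regular_on (fun y : opens_set U => Phi (val y)).
Proof.
move=> loc z Uz; have [f [P [Q [e [m [hf fz hP hQ h]]]]]] := loc z Uz.
exists (Opens (Rat_open_nonzero hf)).
have sub : [set z | peval f (coords z) != 0] `<=` U by move=> z' /h[].
exists sub; split=> //; exists m, P, Q; split=> // y.
by have [_ Qy PhiE] := h _ (set_valP y); split=> //; rewrite -PhiE.
Qed.

Lemma proj_eq z z' : proj z = proj z' <-> ratmap_conj z z'.
Proof.
rewrite /proj /quot_pi; split=> [/eqmodP/asboolP //|h].
by apply/eqmodP/asboolP.
Qed.

(** Two natural exponents stand for one integer power of the resultant, whose sign is not known. *)
Lemma common_multiple_shift D a b : (a = b %[mod D])%N ->
  exists n m, (b + D * n = a + D * m)%N.
Proof.
wlog le : a b / (a <= b)%N.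
  move=> H; have [|/ltnW le /esym/(H _ _ le)[n [m e]]] := leqP a b; first exact: H.
  by exists m, n.
move=> /esym/eqP; rewrite eqn_mod_dvd // => /dvdnP[m e].
by exists 0%N, m; rewrite muln0 addn0 mulnC -e subnKC.
Qed.

Lemma M_coboundary (U : M -> opens M) (g : M -> M -> M -> k) :
  (forall x, opens_set (U x) x) ->
  (forall x y, regular_on (fun p : opens_set (opensI (U x) (U y)) => g x y (val p))) ->
  (forall x p, opens_set (U x) p -> g x x p = 1) ->
  (forall x y (z : M) p, opens_set (U x) p -> opens_set (U y) p -> opens_set (U z) p ->
    g x y p * g y z p = g x z p) ->
  coboundary U g.
Proof.
move=> Ux greg g1 gM; have [rat_of rat_ofE] := line_choice.
have rat_ofP v : pair_res v != 0 -> exists2 c, c != 0 & coords (rat_of v) = c *: v.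
  by move=> /rat_ofE; exact: coords_line.
have rat_ofK z : rat_of (coords z) = z.
  apply/val_inj/val_inj; rewrite rat_ofE; last exact: pair_res_coords.
  exact: hcoordK.
have g0 x y p : opens_set (U x) p -> opens_set (U y) p -> g x y p != 0.
  move=> xp yp; apply/eqP => e; have := gM x y x p xp yp xp.
  by rewrite e mul0r g1 // => /eqP; rewrite eq_sym oner_eq0.
(* The cover and the cocycle are pulled back to the cone; both depend on [v] only through its
   line. *)
pose W x v := pair_res v != 0 /\ opens_set (U x) (proj (rat_of v)).
pose G x y v := g x y (proj (rat_of v)).
pose mres := mpoly_res k d.
have peval_rat_of f e v : f \is e.-homog -> pair_res v != 0 -> 
    (peval f (coords (rat_of v)) != 0) = (peval f v != 0).
  move=> hf /rat_ofP[c c0 ->]; rewrite (pevalZ _ _ hf) mulf_eq0.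
  by rewrite expf_eq0 (negbTE c0) andbF.
have W_open x v : W x v -> exists f e,
    [/\ f \is e.-homog, peval f v != 0 & forall w, peval f w != 0 -> W x w].
  move=> [v0 Uv]; have [f [e [hf fv fU]]] := Rat_open_basis
    (opens_open (quot_preimage (U x))) (Uv : opens_set (quot_preimage (U x)) (rat_of v)).
  (* The factor [mres] keeps the chart inside the cone over Rat_d. *)
  exists (f * mres), (e + (d + d))%N; split; first exact: dhomogM (mpoly_res_homog k d).
    by rewrite pevalM mulf_neq0 ?peval_pair_res // -(peval_rat_of _ _ _ hf).
  move=> w; rewrite pevalM mulf_eq0 negb_or peval_pair_res => /andP[fw w0].
  by split=> //; apply: fU; rewrite (peval_rat_of _ _ _ hf).
have G_regular x y v : W x v -> W y v -> exists f P Q e,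
    [/\ peval f v != 0, P \is e.-homog, Q \is e.-homog & ratunit f P Q (G x y)].
  move=> [v0 xv] [_ yv].
  have [V [h [Vv [m [P [Q [hP hQ hPQ]]]]]]] := greg x y (rat_of v) (conj xv yv).
  have [f [e [hf fv fV]]] := Rat_open_basis (opens_open V) Vv.
  exists (f * mres), P, Q, m; split=> //.
    by rewrite pevalM mulf_neq0 ?peval_pair_res // -(peval_rat_of _ _ _ hf).
  move=> w; rewrite pevalM mulf_eq0 negb_or peval_pair_res => /andP[fw w0].
  have Vw : opens_set V (rat_of w) by apply: fV; rewrite (peval_rat_of _ _ _ hf).
  have [xw yw] : opens_set (opensI (U x) (U y)) (proj (rat_of w)) := h _ Vw.
  have [Qw gw] := hPQ (exist _ (rat_of w) (mem_set Vw)).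
  have Gw : G x y w = peval P (coords (rat_of w)) / peval Q (coords (rat_of w)) := gw.
  have {}Qw : peval Q w != 0 by rewrite -(peval_rat_of _ _ _ hQ).
  have [c c0 cE] := rat_ofP w w0.
  rewrite cE (pevalZ _ _ hP) (pevalZ _ _ hQ) -mulf_div divff ?expf_neq0 // mul1r in Gw.
  split=> //; apply: contraNneq (g0 x y _ xw yw) => Pw.
  by rewrite -/(G x y w) Gw Pw mul0r.
have G_cocycle x y (z : M) v : W x v -> W y v -> W z v -> G x y v * G y z v = G x z v.
  by move=> [_ xv] [_ yv] [_ zv]; exact: gM.
have [a [b [T [Tloc TG]]]] := cocycle_trivial W_open G_regular G_cocycle.
have T0 x v : W x v -> T x v != 0.
  move=> /Tloc[f [X [Y [e [i [j [_ fv _ [_ _ _ h]]]]]]]].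
  by have [X0 Y0 ->] := h v fv; rewrite mulf_neq0 ?invr_neq0.
have WZ x v c : c != 0 -> W x v -> W x (c *: v).
  move=> c0 [v0 Uv]; have cv0 : pair_res (c *: v) != 0 by rewrite pair_resZ_neq0.
  split=> //; suff -> : rat_of (c *: v) = rat_of v by [].
  by apply/val_inj/val_inj; rewrite !rat_ofE // vlineZ.
have TZ x v c : c != 0 -> W x v -> T x (c *: v) * c ^+ a = c ^+ b * T x v.
  move=> c0 Wv; have [f [X [Y [e [i [j [hf fv _ [hX hY ij h]]]]]]]] := Tloc x v Wv.
  have fcv : peval f (c *: v) != 0 by rewrite (pevalZ _ _ hf) mulf_neq0 ?expf_neq0.
  have [_ Yv ->] := h _ fv; have [_ _ ->] := h _ fcv.
  rewrite (pevalZ _ _ hX) (pevalZ _ _ hY); apply: (mulfI (expf_neq0 j c0)).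
  transitivity (c ^+ (i + a) * (peval X v / peval Y v)).
    by rewrite exprD; field; rewrite Yv expf_neq0.
  by rewrite ij exprD; ring.
have Wconj x f v : \det f = 1 -> W x v -> W x (conj_pair f v).
  move=> det_f [v0 Uv]; have fv0 := pair_res_conj_neq0 d_gt0 det_f v0.
  split=> //; suff <- : proj (rat_of v) = proj (rat_of (conj_pair f v)) by [].
  apply/proj_eq; exists f => //; rewrite rat_ofE //.
  by have [c c0 e] := rat_ofP v v0; rewrite -/(coords _) e conj_pairZ vlineZ.
have Tconj x f v : \det f = 1 -> W x v -> T x (conj_pair f v) = T x v.
  apply: (conj_pair_invariant (S := W x)) => {f v} [f v|v]; first exact: Wconj.
  by move=> /Tloc[f [X [Y [e [i [j [_ fv _ [_ _ _ h]]]]]]]]; exists f, X, Y.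
have resconj f v : \det f = 1 -> pair_res v != 0 ->
    pair_res (conj_pair f v) = pair_res v.
  apply: (conj_pair_invariant (S := [set v | pair_res v != 0])) => {f v} [f v|v v0].
    exact: pair_res_conj_neq0.
  exists mres, mres, 1; rewrite peval_pair_res; split=> // w w0.
  by rewrite peval1 oner_neq0 w0 peval_pair_res divr1.
have /common_multiple_shift[n [m nm]] : (a = b %[mod d + d])%N.
  apply: (weight_eq char_k d_gt1) => f v c det_f v0 fv c0.
  have Wv : W (proj (rat_of v)) v by split.
  have := TZ _ _ _ c0 Wv; rewrite -fv Tconj // mulrC => /mulIf; apply; exact: T0.
(* The resultant has weight 2d and no zeros, so it can correct the weight of T. *)
pose S x v := T x v * pair_res v ^+ n / pair_res v ^+ m.
have SZ x v c : c != 0 -> W x v -> S x (c *: v) = S x v.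
  move=> c0 Wv; have [v0 _] := Wv; rewrite /S !pair_resZ !exprMn -!exprM.
  apply: (mulfI (expf_neq0 (a + (d + d) * m) c0)).
  transitivity ((T x (c *: v) * c ^+ a) * c ^+ ((d + d) * n) *
      (pair_res v ^+ n / pair_res v ^+ m)).
    by rewrite exprD; field; rewrite !expf_neq0.
  by rewrite TZ // -nm exprD; ring.
have Sconj x f v : \det f = 1 -> W x v -> S x (conj_pair f v) = S x v.
  by move=> det_f Wv; rewrite /S Tconj // resconj //; case: Wv.
(* This section of the quotient map is arbitrary. Invariance of [S] under scaling and conjugation
   makes [psi] independent of it, and regularity is then tested on Rat_d. *)
pose rep (p : M) : R := repr (p : {eq_quot (ratmap_conj_rel k d)}).
have repK p : proj (rep p) = p by exact: reprK.
pose psi x p := S x (coords (rep p)).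
have Wcoords x z : opens_set (U x) (proj z) -> W x (coords z).
  by move=> Uz; split; [exact: pair_res_coords|rewrite rat_ofK].
have psiE x z : opens_set (U x) (proj z) -> psi x (proj z) = S x (coords z).
  move=> Uz; have /proj_eq[f det_f] : proj z = proj (rep (proj z)) by rewrite repK.
  move=> /coords_line[c c0]; rewrite /psi => ->.
  by rewrite SZ ?Sconj //; [exact: Wcoords | apply: Wconj => //; exact: Wcoords].
have Sloc x v : W x v -> exists f X Y e i, [/\ f \is e.-homog, peval f v != 0,
    X \is i.-homog, Y \is i.-homog & forall w, peval f w != 0 ->
    [/\ W x w, peval X w != 0, peval Y w != 0 & S x w = peval X w / peval Y w]].
  move=> /Tloc[f [X [Y [e [i [j [hf fv fW [hX hY ij h]]]]]]]].
  have hn : mres ^+ n \is ((d + d) * n).-homog by exact/dhomogMn/mpoly_res_homog.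
  have hm : mres ^+ m \is ((d + d) * m).-homog by exact/dhomogMn/mpoly_res_homog.
  (* The choice of [n] and [m] makes numerator and denominator of equal degree, as a regular
     function on projective space requires. *)
  exists f, (X * mres ^+ n), (Y * mres ^+ m), e, (i + (d + d) * n)%N; split=> //.
  - exact: dhomogM.
  - by rewrite (_ : i + _ = j + (d + d) * m)%N; [exact: dhomogM | lia].
  move=> w fw; have Ww := fW w fw; have [w0 _] := Ww; have [Xw Yw Tw] := h w fw.
  have powE l : peval (mres ^+ l) w = pair_res w ^+ l.
    by rewrite -peval_pair_res /peval rmorphXn.
  by split=> //; rewrite /S ?pevalM ?powE ?mulf_neq0 ?expf_neq0 // Tw -mulrA mulf_div.
have psi_regular x : regular_on (fun p : opens_set (U x) => psi x (val p)).
  apply: (@Rat_regular (quot_preimage (U x)) (fun z => psi x (proj z))) => z Uz.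
  have [f [X [Y [e [i [hf fz hX hY h]]]]]] := Sloc x _ (Wcoords x z Uz).
  exists f, X, Y, e, i; split=> // z' fz'; have [[_ Uz'] _ Y0 SE] := h _ fz'.
  by rewrite rat_ofK in Uz'; split=> //; rewrite psiE.
have psiV_regular x : regular_on (fun p : opens_set (U x) => (psi x (val p))^-1).
  apply: (@Rat_regular (quot_preimage (U x)) (fun z => (psi x (proj z))^-1)) => z Uz.
  have [f [X [Y [e [i [hf fz hX hY h]]]]]] := Sloc x _ (Wcoords x z Uz).
  exists f, Y, X, e, i; split=> // z' fz'; have [[_ Uz'] X0 _ SE] := h _ fz'.
  by rewrite rat_ofK in Uz'; split=> //; rewrite psiE // SE invf_div.
exists psi => x; split=> // [p|y p]; rewrite -(repK p); move: (rep p) => z xz.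
  rewrite psiE // /S !mulf_neq0 ?invr_neq0 ?expf_neq0 ?pair_res_coords ?T0 //.
  exact: Wcoords.
move=> yz; rewrite !psiE // /S (TG x y); try exact: Wcoords.
by rewrite /G rat_ofK !mulrA.
Qed.

End RatSpace.

Theorem theorem34 (k : closedFieldType) (d : nat)
    (char_k : [pchar k] =i pred0) (d_gt1 : (1 < d)%N) :
  forall L : Pic (M_space k d), L = Pic1 (M_space k d).
Proof.
apply: Pic_trivial => L; apply: invertible_trivial => U g.
exact: M_coboundary.
Qed.
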